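(* Let $n\ge 2$ and let $\Gamma$ be a discrete subgroup of $\mathbb{Z}$-rank at most $2n-3$ of the additive group $(\mathbb{C}^n,+)$. Let $0<\lambda<1$ and $K>0$. Let $D$ be a subset of $\mathbb{C}^n$ for which there exists a bijective map $\zeta:\Gamma\to D$ with $$\|\zeta(v)-v\| \le \lambda\|v\|+K \quad\text{for all } v\in\Gamma .$$ Then $D$ is a tame discrete subset of $\mathbb{C}^n$.
   Context: $\|\cdot\|$ denotes the standard Hermitian (Euclidean) norm on $\mathbb{C}^n$. A subset of $\mathbb{C}^n$ is called discrete if it has no accumulation point in $\mathbb{C}^n$ (equivalently, every ball of finite radius contains only finitely many of its points). A discrete subset $D\subset\mathbb{C}^n$ ($n\ge 2$) is called tame if there exists a holomorphic automorphism (biholomorphic self-map) $\phi$ of $\mathbb{C}^n$ such that $\phi(D)=\mathbb{Z}\times\{0\}^{n-1}\subset\mathbb{C}\times\mathbb{C}^{n-1}=\mathbb{C}^n$.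
   Formalization: The formal statement adds the hypothesis that Γ is not {0}; for Γ = {0} the set D is a single point, which no automorphism maps onto Z×{0}^{n-1}, so the claim fails in that case. *)

(* Defs.v *)
(* C^n is 'rV[R[i]]_n for R : realType, with the topology
   and the normed R[i]-module structure of the library (sup norm, hence the
   usual topology). *)
From mathcomp Require Export all_boot all_order all_algebra.
From mathcomp Require Export complex.
From mathcomp Require Export all_classical all_reals all_analysis.
Export Order.TTheory GRing.Theory Num.Theory.
Export numFieldNormedType.Exports.
Set Implicit Arguments.
Unset Strict Implicit.
Unset Printing Implicit Defensive.
#[export] Set Implicit Arguments.
#[export] Unset Strict Implicit.
#[export] Unset Printing Implicit Defensive.

Local Open Scope classical_set_scope.
Local Open Scope ring_scope.

(* R-valued, whereas `|z| for z : R[i] lives in R[i]; Normc.normc is the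
   R-valued modulus. *)
Definition hermitian_norm (R : realType) (n : nat) (v : 'rV[R[i]]_n) : R :=
  Num.sqrt (\sum_(j < n) Normc.normc (v ord0 j) ^+ 2).

(* No accumulation point in the whole space; in particular D is closed, so this
   is stronger than the subspace topology on D being discrete. *)
Definition discrete_subset (K : numFieldType) (V : normedModType K)
    (D : set V) : Prop :=
  forall x : V, ~ limit_point D x.

Definition Z_independent (V : zmodType) (k : nat) (v : 'I_k -> V) : Prop :=
  forall c : 'I_k -> int, \sum_(i < k) v i *~ c i = 0 -> forall i, c i = 0.

Definition has_Z_rank (V : zmodType) (G : set V) (r : nat) : Prop :=
  (exists v : 'I_r -> V, (forall i, G (v i)) /\ Z_independent v) /\
  (forall (k : nat) (v : 'I_k -> V),
     (forall i, G (v i)) -> Z_independent v -> (k <= r)%N).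

(* The scalars of 'rV[R[i]]_n are R[i], so differentiability is complex
   (Frechet) differentiability. *)
Definition holomorphic (R : realType) (n m : nat)
    (f : 'rV[R[i]]_n -> 'rV[R[i]]_m) : Prop :=
  forall x, differentiable f x.

Definition holomorphic_automorphism (R : realType) (n : nat)
    (phi : 'rV[R[i]]_n -> 'rV[R[i]]_n) : Prop :=
  holomorphic phi /\
  exists psi : 'rV[R[i]]_n -> 'rV[R[i]]_n,
    [/\ cancel phi psi, cancel psi phi & holomorphic psi].

(* Z x {0}^(n-1) *)
Definition integer_axis (R : realType) (n : nat) : set 'rV[R[i]]_n :=
  [set v | exists k : int,
     v = \row_(j < n) (if val j == 0%N then k%:~R else 0)].
Arguments integer_axis : clear implicits.

Definition tame_discrete (R : realType) (n : nat) (D : set 'rV[R[i]]_n) : Prop :=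
  discrete_subset D /\
  exists phi : 'rV[R[i]]_n -> 'rV[R[i]]_n,
    holomorphic_automorphism phi /\ phi @` D = integer_axis R n.

(* Main.v *)
Require Import Defs.
From HB Require Import structures.
From mathcomp Require Import measurable_realfun.
From mathcomp Require Import ring lra zify.

(** The points of [D] are sparse: a discrete subgroup of rank r has O(S^r)
    points of norm at most S, because rounded real coordinates embed it into the
    integer points of an r-dimensional box ([subgroup_coordinates]), and as
    lambda < 1 the perturbation preserves this bound up to a constant
    ([perturbed_count]).  Here r <= 2n - 3.

    On the other hand the complex lines of C^n form a family of real dimension
    m = 2n - 2, and the directions for which the projection C^n -> C^(n-1)
    along them sends a point of norm S into a fixed ball have volume O(S^-m).
    As r < m, these volumes have a finite sum over [D], so by the Borel-Cantelli
    lemma a generic projection is proper on [D]: the images tend to infinity.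
    A generic direction also avoids the countably many ones for which two images
    coincide.  After a linear change of coordinates the projection is the one
    forgetting the first coordinate ([generic_projection]).

    A sequence whose images z_k in C^(n-1) are distinct and tend to infinity is
    straightened by two shears ([straighten]).  An entire function f on C^(n-1)
    with prescribed values at the z_k exists ([interpolation]), and
    (w, z) |-> (w + f(z), z) puts the first coordinates at the distinct integers.
    These are again discrete, so entire functions g of one variable with
    prescribed values there turn z into 0 by (w, z) |-> (w, z + g(w)).

    The interpolating functions are infinite sums of polynomials; they are shown
    to be complex differentiable by explicit first order expansions with a
    quadratic remainder, bounded multiplicatively ([jet], [jetM], [jet_csum]). *)

Local Open Scope classical_set_scope.
Local Open Scope ring_scope.
Local Open Scope complex_scope.
Local Notation normc := Normc.normc.
Local Notation "x %:C" := (real_complex _ x).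

(** * Real-valued norms and complex differentiability *)

(** The form in which differentiability is checked below: the estimates for
    polynomials and their series give a quadratic remainder directly. *)
Lemma differentiable_quadratic (K : numFieldType) (V W : normedModType K)
    (f : V -> W) (x : V) (L : {linear V -> W}) (M : K) :
  0 <= M -> (forall h, `|L h| <= M * `|h|) ->
  (forall h, `|h| <= 1 -> `|f (x + h) - f x - L h| <= M * `|h| ^+ 2) ->
  differentiable f x.
Proof.
move=> M0 Lb fb.
have Lc : continuous L.
  apply: bounded_linear_continuous; apply/linear_boundedP.
  exists M; split; first exact: ger0_real.
  by move=> y My h; apply: le_trans (Lb h) _; rewrite ler_wpM2r // ltW.
apply/diff_locallyP.
suff E : f \o shift x = cst (f x) + L +o_ 0 id by rewrite (diff_unique Lc E).
apply/eqaddoP => e e0.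
have d0 : 0 < M + 1 + e by rewrite ltr_wpDl // addr_ge0.
apply/nbhs_norm0P; exists (e / (M + 1 + e)); first by rewrite /= divr_gt0.
move=> h /= hlt.
have -> : (f \o shift x - (cst (f x) + L)) h = f (x + h) - f x - L h.
  by rewrite /GRing.add /GRing.opp /= opprD addrA [h + x]addrC.
have h1 : `|h| <= 1.
  apply: le_trans (ltW hlt) _; rewrite ler_pdivrMr // mul1r lerDr.
  by rewrite addr_ge0.
apply: le_trans (fb h h1) _; rewrite expr2 mulrA ler_wpM2r //.
apply: le_trans (_ : (M + 1 + e) * `|h| <= _).
  by rewrite ler_wpM2r // -addrA lerDl addr_ge0 // ltW.
by rewrite mulrC -ler_pdivlMr // ltW.
Qed.

Section SupNorm.
Variables (R : realType).
Local Notation C := R[i].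

Lemma norm_normcE (x : C) : `|x| = (normc x)%:C.
Proof. by case: x => a b; rewrite normc_def. Qed.
Lemma normc_Re_norm (x : C) : normc x = complex.Re `|x|.
Proof. by rewrite norm_normcE. Qed.
Lemma normc_ge0 (x : C) : 0 <= normc x.
Proof. by case: x => a b; apply: sqrtr_ge0. Qed.
Lemma normcD (x y : C) : normc (x + y) <= normc x + normc y.
Proof. exact: le_normcD. Qed.
Lemma normcBC (x y : C) : normc (x - y) = normc (y - x).
Proof. by rewrite !normc_Re_norm distrC. Qed.
Lemma normcM (x y : C) : normc (x * y) = normc x * normc y.
Proof. exact: Normc.normcM. Qed.
Lemma normc_opp (x : C) : normc (- x) = normc x.
Proof. by rewrite !normc_Re_norm normrN. Qed.
Lemma normc_eq0 (x : C) : (normc x == 0) = (x == 0).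
Proof.
apply/eqP/eqP => [/Normc.eq0_normc//|->]; exact: Normc.normc0.
Qed.
Lemma normc_gt0 (x : C) : (0 < normc x) = (x != 0).
Proof. by rewrite lt_def normc_ge0 normc_eq0 andbT. Qed.
Lemma normc_ge_Re (x : C) : `|complex.Re x| <= normc x.
Proof.
case: x => a b /=; rewrite -sqrtr_sqr ler_wsqrtr // lerDl sqr_ge0 //.
Qed.
Lemma normc_ge_Im (x : C) : `|complex.Im x| <= normc x.
Proof.
case: x => a b /=; rewrite -sqrtr_sqr ler_wsqrtr // lerDr sqr_ge0 //.
Qed.
Lemma normc_le_ReIm (x : C) : normc x <= `|complex.Re x| + `|complex.Im x|.
Proof.
case: x => a b /=.
rewrite -[leRHS]ger0_norm ?addr_ge0// -sqrtr_sqr ler_wsqrtr //.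
by rewrite sqrrD !real_normK ?num_real// lerD2r lerDl mulrn_wge0 ?mulr_ge0.
Qed.

Section Vectors.
Variable n : nat.
Implicit Types v : 'rV[C]_n.

(** The norm of row vectors over [R[i]] takes its values in [R[i]]; this is its
    real counterpart, which can be compared with the radii and counts below. *)
Definition sup_norm v : R := complex.Re `|v|.

Lemma sup_normE v : `|v| = (sup_norm v)%:C.
Proof. by rewrite /sup_norm RRe_real // normr_real. Qed.
Lemma sup_norm_ge0 v : 0 <= sup_norm v.
Proof. by have := normr_ge0 v;
  rewrite sup_normE -(rmorph0 (real_complex R)) lecR. Qed.
Lemma sup_normD u v : sup_norm (u + v) <= sup_norm u + sup_norm v.
Proof. by rewrite -lecR rmorphD /= -!sup_normE ler_normD. Qed.
Lemma sup_normBC u v : sup_norm (u - v) = sup_norm (v - u).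
Proof. by rewrite /sup_norm distrC. Qed.
Lemma sup_norm0 : sup_norm 0 = 0.
Proof. by rewrite /sup_norm normr0. Qed.
Lemma sup_norm_eq0 v : (sup_norm v == 0) = (v == 0).
Proof.
by rewrite -[RHS]normr_eq0 sup_normE -[0 in RHS](rmorph0 (real_complex R))
  (inj_eq (@complexI R)).
Qed.
Lemma normc_le_sup_norm v j : normc (v ord0 j) <= sup_norm v.
Proof.
have : mx_norm v <= `|v| by [].
rewrite -lecR -sup_normE -norm_normcE mx_normE.
case/nonnegP: (normr_ge0 v) => e;
  rewrite num_le => /bigmax_leP[_ /(_ (ord0, j) isT)].
by rewrite -num_le.
Qed.
Lemma sup_norm_attained v : v != 0 -> exists j, sup_norm v = normc (v ord0 j).
Proof.
rewrite -normr_eq0 => /mx_norm_neq0 [[i j]]; rewrite (ord1 i) /= => h.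
by exists j; rewrite normc_Re_norm -h.
Qed.
Lemma sup_norm_le v B : 0 <= B -> (forall j, normc (v ord0 j) <= B) ->
  sup_norm v <= B.
Proof.
move=> B0 hB; have [->|/sup_norm_attained [j ->]//] := eqVneq v 0;
  by rewrite sup_norm0.
Qed.
End Vectors.

Lemma holomorphic_quadratic n (f : 'rV[C]_n -> 'rV[C]_n) :
  (forall x, exists (L : 'rV[C]_n -> 'rV[C]_n) (M : R),
  [/\ linear L, forall h, sup_norm (L h) <= M * sup_norm h &
  forall h, sup_norm h <= 1 ->
    sup_norm (f (x + h) - f x - L h) <= M * sup_norm h ^+ 2]) ->
  holomorphic f.
Proof.
move=> H x; have [L [M [linL Lb fb]]] := H x.
pose L' : {linear 'rV[C]_n -> 'rV[C]_n} :=
  HB.pack L (GRing.isLinear.Build C _ _ _ L linL).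
have M0 : 0 <= `|M|%:C by rewrite -(rmorph0 (real_complex R)) lecR.
apply: (@differentiable_quadratic _ _ _ f x L' `|M|%:C M0).
  move=> h; rewrite !sup_normE -rmorphM lecR (le_trans (Lb h)) //.
  by rewrite ler_wpM2r ?sup_norm_ge0 // ler_norm.
move=> h; rewrite sup_normE -(rmorph1 (real_complex R)) lecR => h1.
rewrite sup_normE -rmorphXn -rmorphM lecR (le_trans (fb h h1)) //.
by rewrite ler_wpM2r ?exprn_ge0 ?sup_norm_ge0 // ler_norm.
Qed.
End SupNorm.

(** * Jets with explicit bounds, and series of them *)

Section Jets.
Variables (R : realType) (n : nat).
Local Notation C := R[i].
Local Notation V := 'rV[C]_n.
Implicit Types (f g : V -> C) (z h : V) (M : R).

(** A derivative at [z], together with one constant bounding the value, the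
    derivative and the second order remainder on the unit ball around [z].  The
    bound replaces the Cauchy estimates: it is multiplicative up to a factor 6
    ([jetM]) and adds up along series ([jet_csum]), so that derivatives can be
    taken term by term without any complex integration. *)
Definition jet f z M : Prop := exists L : V -> C,
  [/\ forall a u v, L (a *: u + v) = a * L u + L v,
      normc (f z) <= M,
      forall h, normc (L h) <= M * sup_norm h &
      forall h, sup_norm h <= 1 ->
        normc (f (z + h) - f z - L h) <= M * sup_norm h ^+ 2].

Lemma jet_ge0 f z M : jet f z M -> 0 <= M.
Proof. by case=> L [_ h _ _]; apply: le_trans h; apply: normc_ge0. Qed.

Lemma jet_le f z M M' : M <= M' -> jet f z M -> jet f z M'.
Proof.
move=> MM' [L [L1 L2 L3 L4]]; exists L; split=> //.
- exact: le_trans L2 _.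
- by move=> h; apply: le_trans (L3 h) _; rewrite ler_wpM2r ?sup_norm_ge0.
- move=> h h1; apply: le_trans (L4 h h1) _.
  by rewrite ler_wpM2r ?exprn_ge0 ?sup_norm_ge0.
Qed.

Lemma jet_cst c z : jet (fun=> c) z (normc c).
Proof.
exists (fun=> 0); split=> [a u v||h|h _].
- by rewrite mulr0 addr0.
- by [].
- by rewrite Normc.normc0 mulr_ge0 ?normc_ge0 ?sup_norm_ge0.
- by rewrite !subrr Normc.normc0 mulr_ge0 ?normc_ge0 ?exprn_ge0 ?sup_norm_ge0.
Qed.

Lemma jet_affine j (a b : C) z : a != 0 ->
  jet (fun v => (v ord0 j - b) / a) z ((sup_norm z + 1 + normc b) / normc a).
Proof.
move=> a0; have na : 0 < normc a by rewrite normc_gt0.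
exists (fun h => h ord0 j / a); split=> [c u v||h|h _].
- by rewrite !mxE mulrDl mulrA.
- rewrite normcM Normc.normcV ler_wpM2r ?invr_ge0 ?(ltW na) //.
  apply: le_trans (normcD _ _) _; rewrite normc_opp lerD2r.
  by rewrite (le_trans (normc_le_sup_norm _ _)) // lerDl.
- rewrite normcM Normc.normcV mulrAC ler_wpM2r ?invr_ge0 ?(ltW na) //.
  apply: le_trans (normc_le_sup_norm _ _) _; rewrite ler_peMl ?sup_norm_ge0 //.
  by rewrite addrAC lerDr addr_ge0 ?sup_norm_ge0 ?normc_ge0.
- rewrite !mxE -!mulrBl [_ - _]addrC.
  set t := (X in X * _).
  have -> : t = 0 by rewrite /t; ring.
  rewrite mul0r Normc.normc0 mulr_ge0 ?exprn_ge0 ?sup_norm_ge0 //.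
  by rewrite divr_ge0 ?normc_ge0 // addr_ge0 ?normc_ge0 // addr_ge0
    ?sup_norm_ge0.
Qed.

(** With x the length of the increment, the remainder of the product is
    (f + Lh) r' + Lh L'h + r g(z + h); for x <= 1 the three terms are at most
    2, 1 and 3 times M M' x^2. *)
Lemma jetM f g z M M' : jet f z M -> jet g z M' ->
  jet (fun v => f v * g v) z (6 * M * M').
Proof.
move=> jf jg; have M0 := jet_ge0 jf; have M'0 := jet_ge0 jg.
have MM : 0 <= M * M' by rewrite mulr_ge0.
case: jf => L [L1 L2 L3 L4]; case: jg => L' [L1' L2' L3' L4'].
exists (fun h => f z * L' h + g z * L h); split=> [c u v||h|h h1].
- by rewrite L1 L1'; ring.
- rewrite normcM;
  apply: le_trans (ler_pM (normc_ge0 _) (normc_ge0 _) L2 L2') _; lra.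
- apply: le_trans (normcD _ _) _; rewrite !normcM.
  have A := ler_pM (normc_ge0 _) (normc_ge0 _) L2 (L3' h).
  have B := ler_pM (normc_ge0 _) (normc_ge0 _) L2' (L3 h).
  have : 0 <= M * M' * sup_norm h by rewrite mulr_ge0 ?sup_norm_ge0.
  lra.
set r := f (z + h) - f z - L h; set r' := g (z + h) - g z - L' h.
have -> : f (z + h) * g (z + h) - f z * g z - (f z * L' h + g z * L h)
   = (f z + L h) * r' + L h * L' h + r * (g z + L' h + r').
  rewrite /r /r'; ring.
have x0 := sup_norm_ge0 h; set x := sup_norm h in x0 h1 *.
have x2 : x ^+ 2 <= 1 by rewrite expr_le1.
have x20 : 0 <= x ^+ 2 by rewrite exprn_ge0.
have r1 : normc r <= M * x ^+ 2 by apply: L4.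
have r1' : normc r' <= M' * x ^+ 2 by apply: L4'.
have l1 : normc (L h) <= M * x by apply: L3.
have l1' : normc (L' h) <= M' * x by apply: L3'.
have Mx : M * x <= M by rewrite ler_piMr.
have M'x : M' * x <= M' by rewrite ler_piMr.
have M'x2 : M' * x ^+ 2 <= M' by rewrite ler_piMr.
have A1 : normc ((f z + L h) * r') <= 2 * M * (M' * x ^+ 2).
  rewrite normcM ler_pM ?normc_ge0 //; apply: le_trans (normcD _ _) _; lra.
have A2 : normc (L h * L' h) <= (M * x) * (M' * x).
  by rewrite normcM ler_pM ?normc_ge0.
have A3 : normc (r * (g z + L' h + r')) <= (M * x ^+ 2) * (3 * M').
  rewrite normcM ler_pM ?normc_ge0 //; apply: le_trans (normcD _ _) _.
  have := normcD (g z) (L' h); lra.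
apply: le_trans (normcD _ _) _; apply: le_trans (lerD (normcD _ _) (lexx _)) _.
apply: le_trans (lerD (lerD A1 A2) A3) _.
by rewrite le_eqVlt; apply/orP; left; apply/eqP; ring.
Qed.

(** Normalised by 1/6 so that the factor of [jetM] does not accumulate: a
    function with a jet bounded by 1/12 has k-th powers with jets at most 2^-k. *)
Lemma jetX f z (c : R) k : jet f z (c / 6) ->
  jet (fun v => f v ^+ k) z (c ^+ k).
Proof.
move=> jf; elim: k => [|k IH].
  by have := jet_cst 1 z; rewrite Normc.normc1.
have := jetM jf IH.
rewrite (_ : 6 * (c / 6) * c ^+ k = c ^+ k.+1); last by rewrite exprS; field.
by under [X in jet X]eq_fun do rewrite -exprS.
Qed.

End Jets.

Section ComplexSeries.
Variable R : realType.
Local Notation C := R[i].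

(** Taken through real and imaginary parts, so that convergence is always that
    of real series. *)
Definition csum (u : nat -> C) : C :=
  (limn (series (fun k => complex.Re (u k)))) +i*
  (limn (series (fun k => complex.Im (u k)))).

Definition dominated (M : nat -> R) (u : nat -> C) :=
    exists x : R, forall k, normc (u k) <= x * M k.

Variable M : nat -> R.
Hypothesis Mcvg : cvgn (series M).

Lemma dominated_cvg (w : nat -> R) x : (forall k, `|w k| <= x * M k) ->
   cvgn (series w) /\ `|limn (series w)| <= x * limn (series M).
Proof.
move=> H.
have c1 : cvgn (series (fun k => x * M k)).
  exact: is_cvg_seriesZ.
have c2 : cvgn [normed series w].
  by apply: (series_le_cvg _ _ H c1) => k; rewrite ?(le_trans _ (H k)).
split; first exact: normed_cvg.
apply: le_trans (lim_series_norm c2) _.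
apply: le_trans (lim_series_le c2 c1 H) _.
by rewrite lim_seriesZ.
Qed.

Lemma dominated_Re u : dominated M u ->
  cvgn (series (fun k => complex.Re (u k))).
Proof.
case=> x H; apply: (proj1 (@dominated_cvg _ x _)) => k.
by rewrite (le_trans (normc_ge_Re _)).
Qed.
Lemma dominated_Im u : dominated M u ->
  cvgn (series (fun k => complex.Im (u k))).
Proof.
case=> x H; apply: (proj1 (@dominated_cvg _ x _)) => k.
by rewrite (le_trans (normc_ge_Im _)).
Qed.

Lemma csum_le u x : (forall k, normc (u k) <= x * M k) ->
  normc (csum u) <= 2 * x * limn (series M).
Proof.
move=> H.
have [_ a] : _ /\ _ :=
  @dominated_cvg (fun k => complex.Re (u k)) x
  (fun k => le_trans (normc_ge_Re _) (H k)).
have [_ b] : _ /\ _ :=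
  @dominated_cvg (fun k => complex.Im (u k)) x
  (fun k => le_trans (normc_ge_Im _) (H k)).
apply: le_trans (normc_le_ReIm _) _ => /=; lra.
Qed.

Lemma csumD u w : dominated M u -> dominated M w ->
  csum (fun k => u k + w k) = csum u + csum w.
Proof.
move=> du dw; rewrite /csum.
have -> : (fun k => complex.Re (u k + w k)) =
  (fun k => complex.Re (u k)) + (fun k => complex.Re (w k)).
  by apply/funext => k; rewrite raddfD.
have -> : (fun k => complex.Im (u k + w k)) =
  (fun k => complex.Im (u k)) + (fun k => complex.Im (w k)).
  by apply/funext => k; rewrite raddfD.
rewrite !lim_seriesD;
  [by []|exact: dominated_Im..|exact: dominated_Re|exact: dominated_Re].
Qed.

Lemma csumZ a u : dominated M u -> csum (fun k => a * u k) = a * csum u.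
Proof.
move=> du; rewrite /csum; case: a => a b.
have dr := dominated_Re du; have di := dominated_Im du.
have -> : (fun k => complex.Re ((a +i* b) * u k)) =
  (fun k => a * complex.Re (u k)) - (fun k => b * complex.Im (u k)).
  apply/funext => k; rewrite [RHS]/GRing.add /GRing.opp /=; by case: (u k).
have -> : (fun k => complex.Im ((a +i* b) * u k)) =
  (fun k => a * complex.Im (u k)) + (fun k => b * complex.Re (u k)).
  apply/funext => k; rewrite [RHS]/GRing.add /=; case: (u k) => c d /=; ring.
rewrite lim_seriesB ?lim_seriesD; try exact: is_cvg_seriesZ.
rewrite !lim_seriesZ //.
Qed.

End ComplexSeries.

Lemma csum_finite (R : realType) (u : nat -> R[i]) N :
  (forall k, (N <= k)%N -> u k = 0) ->
  csum u = \sum_(k < N) u k.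
Proof.
move=> H; rewrite /csum.
have S (w : nat -> R) : (forall k, (N <= k)%N -> w k = 0) ->
  limn (series w) = \sum_(k < N) w k.
  move=> Hw; apply/cvg_lim => //; apply: cvg_near_cst.
  exists N => //= k Nk; rewrite /series /= (@big_cat_nat _ _ _ N 0%N k) //=.
  rewrite [X in _ + X]big_nat_cond [X in _ + X]big1 ?addr0 ?big_mkord // => i.
  by move=> /andP[/andP[/Hw]].
rewrite !S; [|by move=> k /H ->..].
rewrite -!raddf_sum; by case: (\sum_ _ _).
Qed.

(** * Interpolation by entire functions *)

Section Interpolation.
Variables (R : realType) (n : nat).
Local Notation C := R[i].
Local Notation V := 'rV[C]_n.
Implicit Types (f g : V -> C) (z h : V) (M : R).

(** The uniformity on bounded sets that all polynomials have. *)
Definition jet_on_balls f :=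
    forall rho : R, exists M, forall v, sup_norm v <= rho -> jet f v M.

Lemma jet_on_ballsM f g : jet_on_balls f -> jet_on_balls g ->
  jet_on_balls (fun v => f v * g v).
Proof.
move=> jf jg rho; have [M HM] := jf rho; have [M' HM'] := jg rho.
by exists (6 * M * M') => v hv; apply: jetM; [apply: HM|apply: HM'].
Qed.

Lemma jet_on_balls_cst c : jet_on_balls (fun=> c).
Proof. by move=> rho; exists (normc c) => v _; apply: jet_cst. Qed.

Lemma jet_on_balls_affine j (a b : C) : a != 0 ->
  jet_on_balls (fun v : V => (v ord0 j - b) / a).
Proof.
move=> a0 rho; exists ((rho + 1 + normc b) / normc a) => v hv.
apply: jet_le (jet_affine j b v a0).
by rewrite ler_wpM2r ?invr_ge0 ?normc_ge0 // !lerD2r.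
Qed.

Lemma jet_on_ballsX f k : jet_on_balls f -> jet_on_balls (fun v => f v ^+ k).
Proof.
move=> jf rho; have [M HM] := jf rho; exists ((6 * M) ^+ k) => v hv.
apply: jetX; rewrite mulrC mulKf //; exact: HM.
Qed.

(** For each [q] in [s] take a coordinate in which [q] differs from [p]; the
    product of the corresponding affine functions does it. *)
Lemma separating (s : seq V) (p : V) : p \notin s ->
  exists g, [/\ g p = 1, forall q, q \in s -> g q = 0 & jet_on_balls g].
Proof.
elim: s => [_|q s IH].
  by exists (fun=> 1); split => //; apply: jet_on_balls_cst.
rewrite inE negb_or => /andP[pq /IH [g [g1 g2 g3]]].
have [j hj] : exists j, p ord0 j != q ord0 j.
  apply/existsP; apply: contraR pq; rewrite negb_exists => /forallP H.
  by apply/eqP/rowP => j; apply/eqP; have := H j; rewrite negbK.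
have a0 : p ord0 j - q ord0 j != 0 by rewrite subr_eq0.
exists (fun v : V => (v ord0 j - q ord0 j) / (p ord0 j - q ord0 j) * g v);
  split.
- by rewrite divff // g1 mulr1.
- move=> x; rewrite inE => /orP[/eqP ->|/g2 ->]; last by rewrite mulr0.
  by rewrite subrr !mul0r.
- by apply: jet_on_ballsM => //; apply: jet_on_balls_affine.
Qed.

(** Multiply a separating polynomial by a high power of v_j / p_j, where j is a
    coordinate in which [p] attains its norm.  On the ball of radius
    |p|/12 - 1 that quotient has jets bounded by 1/12, so the power beats every
    constant, while it is 1 at [p]. *)
Lemma peak (s : seq V) (p : V) (a : C) (eps : R) : 0 < eps -> p \notin s ->
  exists g, [/\ g p = a, forall q, q \in s -> g q = 0, jet_on_balls g &
    forall v, sup_norm v <= sup_norm p / 12 - 1 -> jet g v eps].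
Proof.
move=> eps0 /separating [g [g1 g2 g3]].
have ag : jet_on_balls (fun v => a * g v).
  exact: jet_on_ballsM (jet_on_balls_cst a) g3.
have [small|big] := ltP (sup_norm p / 12 - 1) 0.
  exists (fun v => a * g v); split=> //.
  - by rewrite g1 mulr1.
  - by move=> q /g2 ->; rewrite mulr0.
  - move=> v /le_lt_trans /(_ small); by rewrite ltNge sup_norm_ge0.
have p0 : p != 0 by apply/eqP => p0; move: big; rewrite p0 sup_norm0; lra.
have [j hj] := sup_norm_attained p0.
have npos : 0 < sup_norm p by rewrite lt_def sup_norm_eq0 p0 sup_norm_ge0.
have pj0 : p ord0 j != 0 by rewrite -normc_gt0 -hj.
have [M HM] := ag (sup_norm p / 12 - 1).
(* The jet of the product is at most 6 M 2^-k, which must not exceed eps. *)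
pose k := Num.bound (6 * M / eps).
have kb : 6 * M / eps < 2 ^+ k by apply: upper_nthrootP.
exists (fun v : V => (a * g v) * ((v ord0 j - 0) / p ord0 j) ^+ k); split.
- by rewrite subr0 divff // expr1n g1 !mulr1.
- by move=> q /g2 ->; rewrite mulr0 mul0r.
- apply: jet_on_ballsM => //; apply: jet_on_ballsX; exact: jet_on_balls_affine.
- move=> v hv.
  have jv : jet (fun v : V => ((v ord0 j - 0) / p ord0 j) ^+ k) v (2^-1 ^+ k).
    apply: jetX; apply: jet_le (jet_affine j 0 v pj0).
    rewrite Normc.normc0 addr0 -hj ler_pdivrMr //; lra.
  apply: jet_le (jetM (HM v hv) jv).
  rewrite exprVn ler_pdivrMr ?exprn_gt0 // [eps * _]mulrC -ler_pdivrMr //;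
    exact: ltW.
Qed.

(** Term by term differentiation: values, derivatives and remainders are all
    dominated by the same convergent series of jet bounds. *)
Lemma jet_csum (F : nat -> V -> C) v (M : nat -> R) : cvgn (series M) ->
  (forall k, jet (F k) v (M k)) ->
  jet (fun v => csum (fun k => F k v)) v (2 * limn (series M)).
Proof.
move=> Mc /choice [L HL]; exists (fun h => csum (fun k => L k h)).
have dL h : forall k, normc (L k h) <= sup_norm h * M k.
  by move=> k; case: (HL k) => [_ _ + _]; rewrite mulrC; apply.
have dF : forall k, normc (F k v) <= 1 * M k.
  by move=> k; case: (HL k) => [_ + _ _]; rewrite mul1r; apply.
have d1 h : dominated M (L^~ h) by exists (sup_norm h).
have d2 : dominated M (F^~ v) by exists 1.
have dZ a u : dominated M u -> dominated M (fun k => a * u k).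
  by case=> x Hx; exists (normc a * x) => k;
    rewrite normcM -mulrA ler_wpM2l ?normc_ge0.
split.
- move=> a u w.
  have -> : (fun k => L k (a *: u + w)) = (fun k => a * L k u + L k w).
    by apply/funext => k; case: (HL k) => ->.
  by rewrite (csumD Mc) ?(csumZ Mc) //; apply: dZ.
- by apply: le_trans (csum_le Mc dF) _; rewrite mulr1.
- by move=> h; apply: le_trans (csum_le Mc (dL h)) _; rewrite mulrAC.
- move=> h h1.
  have d3 : dominated M (fun k => F k (v + h)).
    exists 3 => k; case: (HL k) => _ H2 H3 H4.
    have -> : F k (v + h) = F k v + L k h + (F k (v + h) - F k v - L k h).
      by ring.
    have Mk := le_trans (normc_ge0 _) H2.
    have := normcD (F k v) (L k h);
      have := normcD (F k v + L k h) (F k (v + h) - F k v - L k h).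
    have := H3 h; have := H4 h h1.
    have : M k * sup_norm h <= M k by rewrite ler_piMr.
    have : M k * sup_norm h ^+ 2
      <= M k by rewrite ler_piMr // expr_le1 // sup_norm_ge0.
    lra.
  have dr : forall k, normc (F k (v + h) - F k v - L k h)
    <= sup_norm h ^+ 2 * M k.
    by move=> k; case: (HL k) => _ _ _ H4; rewrite mulrC; apply: H4.
  have := csum_le Mc dr.
  have -> : (fun k => F k (v + h) - F k v - L k h) =
    (fun k => (F k (v + h) + -1 * F k v) + -1 * L k h).
    by apply/funext => k; ring.
  rewrite (csumD Mc); last 2 first.
  - case: d3 => x Hx; case: (dZ (-1) _ d2) => y Hy; exists (x + y) => k.
    by apply: le_trans (normcD _ _) _; rewrite mulrDl lerD.
  - exact: dZ.
  rewrite (csumD Mc) ?(csumZ Mc) //; last exact: dZ.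
  by rewrite !mulN1r mulrAC.
Qed.

(** Mittag-Leffler style construction: the k-th term is a peak function at
    [z k] that corrects the value of the partial sum there, vanishes at the
    earlier points, and is at most 2^-k on a ball whose radius tends to infinity
    with k. *)
Lemma interpolation (z : nat -> V) (b : nat -> C) : injective z ->
  (forall B : R, exists N, forall k, (N <= k)%N -> B <= sup_norm (z k)) ->
  exists f, (forall v, exists M, jet f v M) /\ forall k, f (z k) = b k.
Proof.
move=> zinj zpr.
have HP : forall ka : nat * C, exists g, [/\ g (z ka.1) = ka.2,
    forall q, q \in [seq z i | i <- iota 0 ka.1] -> g q = 0,
    jet_on_balls g & forall v, sup_norm v <= sup_norm (z ka.1) / 12 - 1 ->
      jet g v (2^-1 ^+ ka.1)].
  move=> [k a]; apply: peak; first by rewrite exprn_gt0.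
  by rewrite mem_map // mem_iota ltnn andbF.
have {HP} [H HH] := choice HP.
pose S := fix S k v :=
  if k is k'.+1 then S k' v + H (k', b k' - S k' (z k')) v else 0.
pose F k := H (k, b k - S k (z k)).
have SE k v : S k v = \sum_(i < k) F i v.
  by elim: k => [|k IH]; rewrite ?big_ord0 // big_ord_recr /= -IH.
exists (fun v => csum (fun k => F k v)); split; last first.
  move=> j; rewrite (@csum_finite _ _ j.+1).
    rewrite big_ord_recr /= -SE /F;
      case: (HH (j, b j - S j (z j))) => /= -> _ _ _.
    by rewrite addrC subrK.
  move=> k jk; case: (HH (k, b k - S k (z k))) => _ /= H0 _ _; apply: H0.
  by apply/seq.mapP; exists j; rewrite ?mem_iota.
move=> v.
(* From N on, v lies in the ball on which the k-th term is small. *)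
have [N HN] := zpr (12 * (sup_norm v + 1)).
have : forall k, exists M, jet (F k) v M /\ ((N <= k)%N -> M = 2^-1 ^+ k).
  move=> k; case: (HH (k, b k - S k (z k))) => /= _ _ Hb Hs.
  have [Nk|kN] := leqP N k.
    exists (2^-1 ^+ k); split=> //; apply: Hs.
    have := HN k Nk; lra.
  by have [M HM] := Hb (sup_norm v); exists M; split=> //; apply: HM.
move=> /choice [M HM]; exists (2 * limn (series M)); apply: jet_csum;
  last first.
  by move=> k; case: (HM k).
rewrite -(is_cvg_series_restrict N).
rewrite (_ :
  [sequence _]_n = [sequence \sum_(N <= k < m) (geometric 1 (2^-1)) k]_m).
  rewrite is_cvg_series_restrict; apply: is_cvg_geometric_series.
  by rewrite ger0_norm; lra.
apply/funext => m; apply: eq_big_nat => k /andP[Nk _].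
by case: (HM k) => _ /(_ Nk) ->; rewrite /= mul1r.
Qed.

End Interpolation.

(** * Shears, and straightening a sequence with proper projection *)

Section Shears.
Variables (R : realType) (n : nat).
Local Notation C := R[i].
Local Notation V := 'rV[C]_n.

Lemma automorphism_comp (phi psi : V -> V) :
  holomorphic_automorphism phi -> holomorphic_automorphism psi ->
  holomorphic_automorphism (psi \o phi).
Proof.
move=> [h1 [i1 [a1 b1 c1]]] [h2 [i2 [a2 b2 c2]]]; split.
  by move=> x; apply: differentiable_comp; [exact: h1|exact: h2].
exists (i1 \o i2); split.
- exact: can_comp.
- exact: can_comp.
- by move=> x; apply: differentiable_comp; [exact: c2|exact: c1].
Qed.

Variable T : V -> V.
Hypothesis T_linear : linear T.
Hypothesis T_contract : forall h, sup_norm (T h) <= sup_norm h.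

(** [T] is a linear contraction, in practice a coordinate projection, so the
    increment passed on to [g] stays in the unit ball. *)
Lemma holomorphic_shear (g : 'I_n -> V -> C) :
  (forall j v, exists M, jet (g j) v M) ->
  holomorphic (fun v => v + \row_j g j (T v)).
Proof.
move=> gjet; apply: holomorphic_quadratic => x.
have /choice [M HM] : forall j, exists M, jet (g j) (T x) M by move=> j;
  apply: gjet.
have M0 j : 0 <= M j := jet_ge0 (HM j).
have Mle j : M j <= \sum_i M i by rewrite (bigD1 j) //= lerDl sumr_ge0.
have S0 : 0 <= \sum_i M i by apply: sumr_ge0.
have /choice [L HL] := HM.
have TD u v : T (u + v) = T u + T v.
  by have := T_linear 1 u v; rewrite !scale1r.
exists (fun h => h + \row_j L j (T h)), (1 + \sum_i M i); split.
- move=> a u v; apply/rowP => j; rewrite !mxE T_linear;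
  case: (HL j) => -> _ _ _.
  by ring.
- move=> h; apply: le_trans (sup_normD _ _) _; rewrite mulrDl mul1r lerD2l.
  apply: sup_norm_le => [|j]; first by rewrite mulr_ge0 ?sup_norm_ge0.
  rewrite mxE; case: (HL j) => _ _ H _; apply: le_trans (H _) _.
  by apply: ler_pM; rewrite ?sup_norm_ge0.
- move=> h h1; apply: sup_norm_le => [|j].
    by rewrite mulr_ge0 ?exprn_ge0 ?sup_norm_ge0 // addr_ge0.
  rewrite !mxE TD; case: (HL j) => _ _ _ H.
  set r := normc _.
  have -> : r = normc (g j (T x + T h) - g j (T x) - L j (T h)).
    by rewrite /r; congr normc; ring.
  apply: le_trans (H _ (le_trans (T_contract h) h1)) _.
  apply: ler_pM; rewrite ?exprn_ge0 ?sup_norm_ge0 //.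
    by rewrite (le_trans (Mle j)) // lerDr.
  by rewrite lerXn2r ?nnegrE ?sup_norm_ge0.
Qed.

(** Since [T] kills the displacement, [T v] is unchanged by the shear, and
    subtracting the same displacement inverts it. *)
Lemma automorphism_shear (g : 'I_n -> V -> C) :
  (forall j v, exists M, jet (g j) v M) ->
  (forall v, T (\row_j g j v) = 0) ->
  holomorphic_automorphism (fun v => v + \row_j g j (T v)).
Proof.
move=> gjet Tg; split; first exact: holomorphic_shear.
have TB a u v : T (u + a *: v) = T u + a *: T v.
  by rewrite addrC T_linear addrC.
exists (fun v => v + \row_j (-1 * g j (T v))); split.
- move=> v; have := TB 1 v (\row_j g j (T v)); rewrite scale1r => ->.
  rewrite Tg scaler0 addr0; apply/rowP => j; rewrite !mxE; ring.
- move=> v.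
  have -> : \row_j (-1 * g j (T v)) = -1 *: \row_j g j (T v).
    by apply/rowP => j; rewrite !mxE.
  rewrite TB Tg scaler0 addr0; apply/rowP => j; rewrite !mxE; ring.
- apply: (@holomorphic_shear (fun j v => -1 * g j v)) => j v.
  have [M HM] := gjet j v; eexists; apply: jetM HM; exact: jet_cst.
Qed.

End Shears.

Section Straightening.
Variables (R : realType) (n : nat).
Local Notation C := R[i].
Local Notation V := 'rV[C]_n.+1.

Definition axis_part (v : V) : V := \row_j (if j == ord0 then v ord0 j else 0).
Definition off_axis_part (v : V) : V :=
    \row_j (if j == ord0 then 0 else v ord0 j).

Lemma axis_part_linear : linear axis_part.
Proof. by move=> a u v; apply/rowP => j; rewrite !mxE; case: ifP;
  rewrite ?mulr0 ?addr0. Qed.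
Lemma off_axis_part_linear : linear off_axis_part.
Proof. by move=> a u v; apply/rowP => j; rewrite !mxE; case: ifP;
  rewrite ?mulr0 ?addr0. Qed.
Lemma axis_part_contract h : sup_norm (axis_part h) <= sup_norm h.
Proof.
apply: sup_norm_le => [|j]; first exact: sup_norm_ge0.
by rewrite mxE; case: ifP => _;
  rewrite ?normc_le_sup_norm ?Normc.normc0 ?sup_norm_ge0.
Qed.
Lemma off_axis_part_contract h : sup_norm (off_axis_part h) <= sup_norm h.
Proof.
apply: sup_norm_le => [|j]; first exact: sup_norm_ge0.
by rewrite mxE; case: ifP => _;
  rewrite ?normc_le_sup_norm ?Normc.normc0 ?sup_norm_ge0.
Qed.

(** 0, -1, 1, -2, 2, and so on: an explicit enumeration, so that its growth can
    be read off ([int_enum_lb]). *)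
Definition int_enum (k : nat) : int := if odd k then Negz k./2 else Posz k./2.

Lemma int_enum_inj : injective int_enum.
Proof. move=> i j; rewrite /int_enum; do 2 case: ifP; lia. Qed.

Lemma int_enum_surj m : exists k, int_enum k = m.
Proof.
case: m => m; [exists m.*2|exists m.*2.+1]; rewrite /int_enum /= odd_double /=.
  by rewrite doubleK.
by rewrite uphalf_double.
Qed.

Lemma int_enum_lb k : (k <= (`|int_enum k|%N).*2.+1)%N.
Proof. rewrite /int_enum; case: ifP => _; lia. Qed.

Definition axis_point (k : nat) : V :=
    \row_j (if j == ord0 then (int_enum k)%:~R else 0).

Lemma axis_pointE : range axis_point = integer_axis R n.+1.
Proof.
apply/seteqP; split=> [_ [k _ <-]|v [m ->]] /=.
  by exists (int_enum k).
by have [k <-] := int_enum_surj m; exists k.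
Qed.

Lemma normc_int (m : int) : normc (m%:~R : C) = (`|m|%N)%:R.
Proof.
apply: (@complexI R); by rewrite -norm_normcE -intr_norm natr_absz rmorph_int.
Qed.

(** Two interpolating shears suffice.  Because the off-axis parts are distinct
    and tend to infinity, a function of the off-axis part can move the axis
    coordinate of the k-th point to the k-th integer; because the integers are
    distinct and tend to infinity, functions of the axis coordinate can then
    cancel the off-axis part. *)
Lemma straighten (v : nat -> V) :
  injective (off_axis_part \o v) ->
  (forall B : R, exists N, forall k, (N <= k)%N ->
    B <= sup_norm (off_axis_part (v k))) ->
  exists phi,
    holomorphic_automorphism phi /\ phi @` range v = integer_axis R n.+1.
Proof.
move=> inj prop.
have [f [fjet fE]] :=
  interpolation (fun k => (int_enum k)%:~R - v k ord0 ord0) inj prop.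
have axis_inj : injective axis_point.
  by move=> i j /rowP /(_ ord0); rewrite !mxE eqxx => /intr_inj /int_enum_inj.
have axis_prop (B : R) : exists N, forall k, (N <= k)%N ->
  B <= sup_norm (axis_point k).
  exists (Num.bound `|B|).*2.+1 => k hk.
  apply: le_trans (normc_le_sup_norm _ ord0); rewrite mxE eqxx normc_int.
  apply: le_trans (ler_norm _) _.
  apply: le_trans (ltW (archi_boundP (normr_ge0 _))) _; rewrite ler_nat.
  by rewrite -leq_double -ltnS (leq_trans hk) // int_enum_lb.
have /choice [g Hg] : forall j : 'I_n.+1, exists g : V ->
  C, (forall v, exists M, jet g v M) /\
    forall k, g (axis_point k) = - v k ord0 j.
  by move=> j; apply: interpolation.
pose f' (j : 'I_n.+1) : V -> C := if j == ord0 then f else fun=> 0.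
pose g' (j : 'I_n.+1) : V -> C := if j == ord0 then fun=> 0 else g j.
have A1 : holomorphic_automorphism
  (fun v : V => v + \row_j f' j (off_axis_part v)).
  apply: (@automorphism_shear _ _ _ off_axis_part_linear
    off_axis_part_contract f').
    move=> j w; rewrite /f'; case: ifP => _; first exact: fjet.
    by eexists; apply: jet_cst.
  by move=> w; apply/rowP => j; rewrite !mxE /f'; case: (j == ord0).
have A2 : holomorphic_automorphism (fun v : V => v + \row_j g' j (axis_part v)).
  apply: (@automorphism_shear _ _ _ axis_part_linear axis_part_contract g').
    move=> j w; rewrite /g'; case: ifP => _; last by case: (Hg j).
    by eexists; apply: jet_cst.
  by move=> w; apply/rowP => j; rewrite !mxE /g'; case: (j == ord0).
exists ((fun v : V => v + \row_j g' j (axis_part v)) \o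
  (fun v : V => v + \row_j f' j (off_axis_part v))).
split; first exact: automorphism_comp.
rewrite -axis_pointE image_comp; congr (_ @` _).
apply/funext => k /=.
set u := v k + _.
have uE : u = \row_j (if j == ord0 then (int_enum k)%:~R else v k ord0 j).
  apply/rowP => j; rewrite !mxE /f'; case: ifP => [/eqP ->|_];
    last by rewrite addr0.
  by have := fE k; rewrite /= => ->; rewrite addrC subrK.
have aE : axis_part u = axis_point k.
  by apply/rowP => j; rewrite uE !mxE; case: (j == ord0).
rewrite aE uE; apply/rowP => j; rewrite !mxE /g'; case: ifP => _;
  first by rewrite addr0.
by case: (Hg j) => _ ->; rewrite subrr.
Qed.

End Straightening.

(** * A Borel-Cantelli lemma with weights *)

Definition bounded_sums (R : realType) (u : nat -> R) :=
    exists B : R, forall N, \sum_(k < N) u k <= B.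

(** The integral of the weighted sum of indicators is the weighted sum of the
    measures, hence finite, so the sum itself is finite almost everywhere. *)
Lemma weighted_borel_cantelli (d : measure_display) (T : measurableType d)
    (R : realType)
   (mu : {measure set T -> \bar R}) (E : nat -> set T) (W : nat -> R) (B : R) :
  (forall k, measurable (E k)) -> (forall k, 0 <= W k) ->
  (forall N, (\sum_(k < N) (W k)%:E * mu (E k) <= B%:E)%E) ->
  mu.-negligible [set t | ~ bounded_sums (fun k => W k * \1_(E k) t)].
Proof.
move=> mE W0 HB.
pose f k (t : T) : \bar R := ((W k)%:E * (\1_(E k) t)%:E)%E.
have f0 k t : (0 <= f k t)%E by rewrite mule_ge0 ?lee_fin.
have mf k : measurable_fun setT (f k).
  by apply: emeasurable_funM => //; apply/measurable_EFinP;
    apply: measurable_indic.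
have intf k : (\int[mu]_t f k t = (W k)%:E * mu (E k))%E.
  rewrite ge0_integralZl_EFin //; last first.
    by apply/measurable_EFinP; apply: measurable_indic.
  by rewrite integral_indic // setIT.
have fin : (\int[mu]_t (\sum_(0 <= k <oo) f k t) < +oo)%E.
  rewrite integral_nneseries //.
  apply: (@le_lt_trans _ _ B%:E); last exact: ltry.
  apply: lime_le.
    by apply: is_cvg_nneseries => k _ _; apply: integral_ge0.
  apply: nearW => N; rewrite big_mkord; under eq_bigr do rewrite intf;
    exact: HB.
have msum : measurable_fun setT (fun t => \sum_(0 <= k <oo) f k t)%E.
  by apply: ge0_emeasurable_sum.
have s0 t : (0 <= \sum_(0 <= k <oo) f k t)%E by apply: nneseries_ge0.
have iD : mu.-integrable setT (fun t => \sum_(0 <= k <oo) f k t)%E.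
  apply/integrableP; split=> //.
  by under eq_integral do rewrite gee0_abs //.
apply: negligibleS (integrable_ae measurableT iD) => t /= nb tfin; apply: nb.
have {}tfin := tfin I.
exists (fine (\sum_(0 <= k <oo) f k t)%E) => N.
rewrite -lee_fin fineK // -sumEFin.
apply: le_trans (nneseries_lim_ge N _) => //.
by rewrite big_mkord; apply: lee_sum => k _; rewrite /f -EFinM.
Qed.

Section Intervals.
Variable R : realType.
Implicit Types (u W rho x : nat -> R).

(** The countable set [Q] of values to avoid comes for free, being a null set;
    it is what later makes the projection injective. *)
Lemma borel_cantelli_intervals W rho x (Q : set R) : countable Q ->
  (forall k, 0 <= W k) -> (forall k, 0 <= rho k) ->
  bounded_sums (fun k => W k * rho k) ->
  exists t, [/\ 0 <= t <= 1, ~ Q t &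
    bounded_sums (fun k => W k * (`|x k - t| <= rho k)%R%:R)].
Proof.
move=> Qc W0 r0 [B HB].
pose mu := @lebesgue_measure R.
pose E k : set (measurableTypeR R) := `[x k - rho k, x k + rho k]%classic.
have mE k : measurable (E k) by exact: measurable_itv.
have muE k : mu (E k) = (2 * rho k)%:E.
  rewrite /mu lebesgue_measure_itv /= lte_fin; have := r0 k.
  rewrite le_eqVlt => /predU1P[<-|rk]; first by rewrite subr0 addr0 ltxx mulr0.
  by rewrite ifT; [congr (_%:E); ring|lra].
have HB' N : (\sum_(k < N) (W k)%:E * mu (E k) <= (2 * B)%:E)%E.
  under eq_bigr do rewrite muE -EFinM.
  rewrite sumEFin lee_fin.
  under eq_bigr do rewrite mulrCA.
  by rewrite -mulr_sumr ler_pM2l.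
have [A [mA A0 sA]] := weighted_borel_cantelli mE W0 HB'.
have mQ : measurable (Q : set (measurableTypeR R)) by apply:
  countable_measurable.
pose D : set (measurableTypeR R) := `[0, 1]%classic.
have mD : measurable D by exact: measurable_itv.
have [t [tD tQ tfin]] :
  exists t, [/\ D t, ~ Q t & bounded_sums (fun k => W k * \1_(E k) t)].
  apply: contrapT => H.
  have DAQ : D `<=` A `|` Q.
    move=> t Dt; apply: contrapT => /not_orP[nA nQ]; apply: H; exists t;
      split=> //.
    by apply: contrapT => nf; apply: nA; apply: sA.
  have : (mu D <= 0)%E.
    apply: le_trans (le_measure _ _ _ DAQ) _; rewrite ?inE //.
      exact: measurableU.
    have muA : mu A = 0%E by exact: A0.
    have muQ : mu Q = 0%E by exact: countable_lebesgue_measure0.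
    have : (mu (A `|` Q) <= mu A + mu Q)%E by exact: measureU2.
    by rewrite muA muQ adde0.
  by rewrite /mu lebesgue_measure_itv /= lte_fin ltr01 oppr0 adde0 lee_fin
    ler10.
exists t; split=> //.
case: tfin => b Hb; exists b => N; apply: le_trans (Hb N).
apply: ler_sum => k _; rewrite ler_wpM2l //.
rewrite indicE /E mem_setE in_itv /= ler_distl.
have -> // :
  (x k - rho k <= t <= x k + rho k) = (t - rho k <= x k <= t + rho k).
by apply/idP/idP => /andP[? ?]; apply/andP; split; lra.
Qed.

End Intervals.

Section Cubes.
Variable R : realType.

Lemma bounded_sums_le (u v : nat -> R) : (forall k, v k <= u k) ->
  bounded_sums u -> bounded_sums v.
Proof.
by move=> vu [B HB]; exists B => N; apply: le_trans (HB N); apply: ler_sum.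
Qed.

(** A volume estimate in dimension [m] obtained without product measures: the
    coordinates of [t] are chosen one at a time, and after each choice the
    weights record which of the cubes are still met.  Carrying weights through
    the induction is what makes the one-dimensional lemma applicable again. *)
Lemma borel_cantelli_weighted_cubes m (W rho : nat -> R) (x : nat -> nat -> R)
    (Q : set R) :
  countable Q ->
  (forall k, 0 <= W k) -> (forall k, 0 <= rho k) ->
  bounded_sums (fun k => W k * rho k ^+ m) ->
  exists t : nat -> R, (forall i, (i < m)%N -> 0 <= t i <= 1 /\ ~ Q (t i)) /\
    bounded_sums
      (fun k => W k * [forall i : 'I_m, `|x k i - t i| <= rho k]%R%:R).
Proof.
move=> Qc W0 r0; elim: m W W0 => [|m IH] W W0 HW.
  exists (fun=> 0); split=> //; apply: bounded_sums_le HW => k; rewrite expr0.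
  by rewrite ler_wpM2l // lern1 leq_b1.
have [||s [s01 sQ]] :=
  @borel_cantelli_intervals R (fun k => W k * rho k ^+ m) rho (x ^~ m) Q Qc _
  r0.
- by move=> k; rewrite mulr_ge0 ?exprn_ge0.
- by apply: bounded_sums_le HW => k; rewrite -mulrA -exprSr.
move=> Hs.
have [||t [tQ Ht]] := IH (fun k => W k * (`|x k m - s| <= rho k)%R%:R).
- by move=> k; rewrite mulr_ge0.
- by apply: bounded_sums_le Hs => k; rewrite mulrAC.
exists (fun i => if i == m then s else t i); split.
  move=> i; rewrite ltnS leq_eqVlt; case: eqVneq => [->|_] //= im; exact: tQ.
apply: bounded_sums_le Ht => k.
rewrite -mulrA ler_wpM2l // -natrM ler_nat mulnb.
case: forallP => // H; rewrite lt0b.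
have := H ord_max; rewrite /= eqxx => ->; apply/forallP => i.
by have := H (widen_ord (leqnSn m) i); rewrite /= ltn_eqF.
Qed.

Lemma bounded_sums_indicator (b : nat -> bool) :
  bounded_sums (fun k => (b k)%:R : R) -> exists N, forall k, (N <= k)%N ->
    ~~ b k.
Proof.
move=> [B HB].
apply: contrapT => H.
have inf N : exists k, (N <= k)%N && b k.
  apply: contrapT => H'; apply: H; exists N => k Nk; apply/negP => bk.
  by apply: H'; exists k; rewrite Nk.
have grow M : exists N, M%:R <= \sum_(k < N) (b k)%:R :> R.
  elim: M => [|M [N HN]]; first by exists 0%N; rewrite big_ord0.
  have [k /andP[Nk bk]] := inf N; exists k.+1.
  rewrite big_ord_recr /= bk -natr1 lerD2r (le_trans HN) //.
  rewrite -!(big_mkord xpredT (fun i => (b i)%:R : R)).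
  by rewrite (@big_cat_nat _ _ _ N 0%N k) //= lerDl sumr_ge0.
have [N HN] := grow (Num.bound `|B|).+1.
have := le_trans HN (HB N); apply/negP; rewrite -ltNge.
apply: le_lt_trans (ler_norm _) _;
  apply: lt_trans (archi_boundP (normr_ge0 _)) _.
by rewrite ltr_nat.
Qed.

(** All weights are 1 here, so the weighted sum counts the cubes that contain
    the point. *)
Lemma borel_cantelli_cubes m (rho : nat -> R) (x : nat -> nat -> R)
    (Q : set R) :
  countable Q -> (forall k, 0 <= rho k) ->
  bounded_sums (fun k => rho k ^+ m) ->
  exists t : nat -> R, (forall i, (i < m)%N -> 0 <= t i <= 1 /\ ~ Q (t i)) /\
   exists N, forall k, (N <= k)%N ->
     exists2 i, (i < m)%N & rho k < `|x k i - t i|.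
Proof.
move=> Qc r0 Hr.
have [||t [Ht Hs]] :=
  @borel_cantelli_weighted_cubes m (fun=> 1) rho x Q Qc _ r0.
- by [].
- by apply: bounded_sums_le Hr => k; rewrite mul1r.
exists t; split=> //.
have [|N HN] :=
  @bounded_sums_indicator
  (fun k => [forall i : 'I_m, `|x k i - t i| <= rho k]%R).
  by apply: bounded_sums_le Hs => k; rewrite mul1r.
exists N => k /HN; rewrite negb_forall => /existsP[j]; rewrite -ltNge => h.
by exists j.
Qed.
End Cubes.

(** * Shells and counting *)

Section Counting.
Variable R : realType.

Lemma shell_sum (J : nat -> nat) (h : nat -> R) (A : R) :
  (forall N j, #|[pred k : 'I_N | J k == j]|%:R * h j <= A * 2^-1 ^+ j) ->
  bounded_sums (h \o J).
Proof.
move=> cnt; exists (2 * A) => N /=.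
have A0 : 0 <= A.
  have := cnt 0%N 0%N; rewrite expr0 mulr1 (_ : #|_| = 0%N) ?mul0r //.
  by apply: eq_card0 => -[].
pose M := \max_(k < N) J k.
have JM (k : 'I_N) : (J k < M.+1)%N by rewrite ltnS (leq_bigmax k).
rewrite (partition_big (fun k : 'I_N => Ordinal (JM k)) xpredT) //=.
have geo K : \sum_(j < K) 2^-1 ^+ j <= 2 :> R.
  have -> : \sum_(j < K) 2^-1 ^+ j = 2 - 2 * 2^-1 ^+ K :> R.
    elim: K => [|K IH]; first by rewrite big_ord0 expr0; ring.
    by rewrite big_ord_recr /= IH exprS; field.
  by rewrite lerBlDr lerDl mulr_ge0 // exprn_ge0.
apply: le_trans (_ : \sum_(j < M.+1) A * 2^-1 ^+ j <= _); last first.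
  by rewrite -mulr_sumr mulrC ler_wpM2r.
apply: ler_sum => j _; apply: le_trans (cnt N j).
rewrite (eq_bigr (fun=> h j)); last by move=> k /eqP <-.
rewrite sumr_const mulr_natl.
rewrite le_eqVlt; apply/orP; left; apply/eqP; congr (_ *+ _).
Qed.

Lemma count_proper (a : nat -> R) (c : nat -> nat) :
  (forall N S, (#|[pred k : 'I_N | (a k <= S%:R)%R]| <= c S)%N) ->
  forall B : R, exists N, forall k, (N <= k)%N -> B <= a k.
Proof.
move=> cnt B;
  have [|N HN] :=
  @bounded_sums_indicator R (fun k => a k <= (Num.bound `|B|)%:R).
  exists (c (Num.bound `|B|))%:R => N.
  apply: le_trans (_ : #|[pred k : 'I_N | a k <= (Num.bound `|B|)%:R]|%:R <= _).
    rewrite -sum1_card natr_sum [leRHS]big_mkcond /=; apply: ler_sum => k _.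
    by rewrite inE; case: ifP.
  by rewrite ler_nat.
exists N => k /HN; rewrite -ltNge => /ltW; apply: le_trans.
by apply: le_trans (ler_norm _) _; apply: ltW; apply: archi_boundP.
Qed.

End Counting.

Section Projection.
Variables (R : realType) (n : nat).
Local Notation C := R[i].
Local Notation V := 'rV[C]_n.+2.
Local Notation m := (n.*2.+2).
Local Notation b := (2 ^ m.*2)%N.

(** Logarithmic size.  The base is 2^(2m) so that the factor 2^j allowed in
    [shell_radius] costs only a factor 2^(m j) in volume, which is less than the
    gain of one power of the base per shell. *)
Definition shell (a : R) := trunc_log b (Num.truncn a).+1.
(** Slightly larger than the inverse of the size: 2^j is the margin which
    makes the projected points tend to infinity. *)
Definition shell_radius (j : nat) : R := 2 ^+ j / b%:R ^+ j.

Lemma shell_lb (a : R) : 0 <= a -> b%:R ^+ (shell a) <= a + 1.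
Proof.
move=> a0; apply: le_trans (_ : (Num.truncn a).+1%:R <= _).
  by rewrite -natrX ler_nat trunc_logP // (@ltn_exp2l 2 0).
by rewrite -natr1 lerD2r; case/andP: (truncn_itv a0).
Qed.

Lemma shell_ub (a : R) : 0 <= a -> a <= b%:R ^+ (shell a).+1.
Proof.
move=> a0; apply: le_trans (_ : (Num.truncn a).+1%:R <= _).
  by apply: ltW; case/andP: (truncn_itv a0).
by rewrite -natrX ler_nat ltnW // trunc_log_ltn // (@ltn_exp2l 2 0).
Qed.

Lemma shell_ge (a : R) j : b%:R ^+ j <= a -> (j <= shell a)%N.
Proof.
move=> ja; have a0 : 0 <= a by apply: le_trans ja; rewrite exprn_ge0.
apply: trunc_log_max; first by rewrite (@ltn_exp2l 2 0).
rewrite -(ler_nat R) natrX; apply: le_trans ja _.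
by apply: ltW; case/andP: (truncn_itv a0).
Qed.

(** The j-th shell has O(base^(j (m - 1))) points, each contributing
    (2^m)^j / base^(j m); the sum over the shells is geometric of ratio
    2^m / base = 2^-m. *)
Lemma shell_radius_summable (a : nat -> R) (c : nat) : (forall k, 0 <= a k) ->
  (forall N S, (#|[pred k : 'I_N | (a k <= S%:R)%R]| <= c * S.+1 ^ m.-1)%N) ->
  bounded_sums (fun k => shell_radius (shell (a k)) ^+ m).
Proof.
move=> a0 cnt.
apply: (@shell_sum R (shell \o a) (fun j => shell_radius j ^+ m)
  (c * (2 * b) ^ m.-1)%:R) => N j.
have le1 : (#|[pred k : 'I_N | (shell \o a) k == j]|
  <= (c * (2 * b) ^ m.-1) * (b ^ m.-1) ^ j)%N.
  apply: leq_trans (_ : c * (b ^ j.+1).+1 ^ m.-1 <= _)%N.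
    apply: leq_trans (cnt N (b ^ j.+1)%N);
      apply/subset_leq_card/fintype.subsetP => k.
    by rewrite !inE => /eqP <-; rewrite natrX; apply: shell_ub.
  rewrite -mulnA leq_mul2l; apply/orP; right.
  have -> : ((b ^ m.-1) ^ j = (b ^ j) ^ m.-1)%N by rewrite -!expnM
    [(m.-1 * j)%N]mulnC.
  rewrite -expnMn.
  rewrite leq_exp2r // -mulnA -expnS.
  have : (0 < b ^ j.+1)%N by rewrite !expn_gt0.
  by move: (b ^ j.+1)%N => B B0; lia.
have rho0 : 0 <= shell_radius j ^+ m.
  by rewrite exprn_ge0 // divr_ge0 // exprn_ge0.
apply: le_trans
  (_ : (c * (2 * b) ^ m.-1 * (b ^ m.-1) ^ j)%:R * shell_radius j ^+ m <= _).
  by rewrite ler_wpM2r // ler_nat.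
rewrite natrM -mulrA ler_wpM2l //.
have b0 : (0 : R) < b%:R by rewrite ltr0n expn_gt0.
have -> : ((b ^ m.-1) ^ j)%:R * shell_radius j ^+ m = (2 ^+ m / b%:R) ^+ j :> R.
  rewrite /shell_radius; move: b b0 => q q0.
  rewrite expr_div_n -!exprM [(j * m)%N]mulnC !exprM -expr_div_n.
  rewrite !natrX -exprMn; congr (_ ^+ j); rewrite [q%:R ^+ m]exprS /=.
  by field; rewrite expf_neq0 ?andbT gt_eqF.
apply: lerXn2r; rewrite ?nnegrE ?invr_ge0 ?divr_ge0 ?exprn_ge0 ?(ltW b0) //.
rewrite -[leRHS]mul1r ler_pdivlMr // mulrAC ler_pdivrMr // mul1r.
by rewrite -natrX -natrM ler_nat -expnSr leq_exp2l //; lia.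
Qed.
End Projection.

(** * A generic linear projection *)

Lemma shell_radius_arith (R : realType) (B P q a : R) :
  0 <= B -> 0 <= P -> 2 <= q -> q <= a + 1 -> 8 * B <= P -> B <= P / q * a / 4.
Proof.
move=> B0 P0 q2 qa BP.
have a0 : 0 <= a by lra.
have q0 : 0 < q by lra.
rewrite ler_pdivlMr // mulrAC ler_pdivlMr //.
have half : q <= 2 * a by lra.
have := ler_wpM2l B0 half; have := ler_wpM2r a0 BP; lra.
Qed.

Section GenericProjection.
Variables (R : realType) (n : nat).
Local Notation C := R[i].
Local Notation V := 'rV[C]_n.+2.
Local Notation m := (n.*2.+2).
Local Notation b := (2 ^ m.*2)%N.

Definition lin_shear (c : 'I_n.+2 -> C) (v : V) : V :=
  v + \row_j (if j == ord0 then 0 else - c j * axis_part v ord0 ord0).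

Lemma automorphism_lin_shear c : holomorphic_automorphism (lin_shear c).
Proof.
pose g (j : 'I_n.+2) : V -> C :=
  if j == ord0 then fun=> 0 else fun v => - c j * ((v ord0 ord0 - 0) / 1).
have -> : lin_shear c = fun v : V => v + \row_j g j (axis_part v).
  apply/funext => v; congr (_ + _); apply/rowP => j; rewrite !mxE /g /=.
  by case: ifP => _; rewrite ?mxE ?eqxx ?subr0 ?divr1.
apply: (@automorphism_shear _ _ _ (@axis_part_linear R n.+1)
  (@axis_part_contract R n.+1) g).
  move=> j v; rewrite /g; case: ifP => _; first by eexists; apply: jet_cst.
  eexists; apply: jetM; first exact: jet_cst.
  by apply: jet_affine; rewrite oner_neq0.
by move=> v; apply/rowP => j; rewrite !mxE /g; case: (j == ord0).
Qed.

Lemma off_axis_lin_shear c v j : j != ord0 ->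
  off_axis_part (lin_shear c v) ord0 j = v ord0 j - c j * v ord0 ord0.
Proof. by move=> /negPf j0; rewrite !mxE j0 eqxx mulNr. Qed.

(** Write v = (w, z).  The point v is projected to z - c w, and when w is not
    small compared with v this is small only if c lies in a small cube around
    z / w, of real dimension [m] = 2 (n + 1).  A growth exponent below [m] makes
    the volumes of these cubes summable, so a generic c lies in finitely many of
    them; when w is small, z dominates for every bounded c.  Collisions of two
    projected points happen for countably many values of Re c_1 only. *)
Lemma generic_projection (v : nat -> V) (c0 : nat) : injective v ->
  (forall N S,
    (#|[pred k : 'I_N | (sup_norm (v k) <= S%:R)%R]| <= c0 * S.+1 ^ m.-1)%N) ->
  exists c, injective (fun k => off_axis_part (lin_shear c (v k))) /\
   (forall B : R, exists N, forall k, (N <= k)%N ->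
     B <= sup_norm (off_axis_part (lin_shear c (v k)))).
Proof.
move=> vinj cnt.
have vprop := count_proper (a := fun k => sup_norm (v k)) cnt.
(* The m real parameters are numbered so that 2(j-1) and 2(j-1)+1 are the real
   and imaginary parts of c_j. *)
pose coord (i : nat) : 'I_n.+2 := inord i./2.+1.
pose part i (z : C) := if odd i then complex.Im z else complex.Re z.
pose x k i := part i (v k ord0 (coord i) / v k ord0 ord0).
pose Q : set R := range (fun kl : nat * nat =>
  complex.Re ((v kl.1 ord0 (coord 0%N) - v kl.2 ord0 (coord 0%N)) /
    (v kl.1 ord0 ord0 - v kl.2 ord0 ord0))).
have Qc : countable Q by exact: sub_countable (card_image_le _ _)
  (countableP _).
pose J k := shell n (sup_norm (v k)).
pose rho k : R := shell_radius R n (J k).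
have rho0 k : 0 <= rho k by rewrite divr_ge0 // exprn_ge0.
have sumr : bounded_sums (fun k => rho k ^+ m).
  by apply: shell_radius_summable cnt => k; apply: sup_norm_ge0.
have [t [tQ [N0 HN0]]] := borel_cantelli_cubes x Qc rho0 sumr.
pose c (j : 'I_n.+2) : C := t (val j).-1.*2 +i* t (val j).-1.*2.+1.
have coordV i : (i < m)%N -> val (coord i) = i./2.+1.
  by move=> im; rewrite /coord /= inordK //; lia.
have coord_neq0 i : (i < m)%N -> coord i != ord0.
  by move=> /coordV h; apply/eqP => /(congr1 val); rewrite h.
have partc i : (i < m)%N -> part i (c (coord i)) = t i.
  move=> im; rewrite /part /c coordV //=; case: ifP => oi /=; congr t; lia.
exists c; split.
  move=> k l /= E.
  have Ej j : j != ord0 ->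
    v k ord0 j - v l ord0 j = c j * (v k ord0 ord0 - v l ord0 ord0).
    move=> j0; have := congr1 (fun u : V => u ord0 j) E;
      rewrite !off_axis_lin_shear //.
    move=> /eqP; rewrite -subr_eq0 => /eqP E'; apply/eqP; rewrite -subr_eq0 -E'.
    by apply/eqP; ring.
  have [w0|w0] := eqVneq (v k ord0 ord0 - v l ord0 ord0) 0.
    apply/vinj/rowP => j; apply/eqP; rewrite -subr_eq0.
    have [->|/Ej ->] := eqVneq j ord0; first by rewrite w0.
    by rewrite w0 mulr0.
  (* The real part of c_1 would be one of the excluded values. *)
  have [_ []] := tQ 0%N isT.
  exists (k, l) => //=; rewrite Ej ?coord_neq0 // mulfK //; exact: (partc 0%N).
have nc_c (j : 'I_n.+2) : j != ord0 -> normc (c j) <= 2.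
  move=> j0; apply: le_trans (normc_le_ReIm _) _ => /=.
  have j0' : (0 < val j)%N by rewrite lt0n; apply: contra j0 => /eqP h;
    apply/eqP/val_inj.
  have lj := ltn_ord j.
  have [/andP[t1 t2] _] :
    0 <= t (val j).-1.*2 <= 1 /\ ~ Q (t (val j).-1.*2) by apply: tQ;
    rewrite /=; lia.
  have [/andP[t3 t4] _] :
    0 <= t (val j).-1.*2.+1 <= 1 /\ ~ Q (t (val j).-1.*2.+1) by apply: tQ;
    rewrite /=; lia.
  by rewrite !ger0_norm //; lra.
have q1 : 1 < b%:R :> R by rewrite ltr1n (@ltn_exp2l 2 0).
have lower k : (N0 <= k)%N -> 1 <= sup_norm (v k) ->
    rho k * sup_norm (v k) / 4 <= sup_norm (off_axis_part (lin_shear c (v k))).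
  move=> Nk v1.
  have rho1 : rho k <= 1.
    rewrite ler_pdivrMr ?exprn_gt0 ?(lt_trans ltr01) // mul1r.
    apply: lerXn2r; rewrite ?nnegrE //.
    by rewrite ler_nat -[2%N]expn1 leq_exp2l //.
  have [small|large] := lerP (normc (v k ord0 ord0)) (sup_norm (v k) / 4).
    have v0 : v k != 0 by rewrite -sup_norm_eq0 gt_eqF // (lt_le_trans ltr01).
    have [j hj] := sup_norm_attained v0.
    have j0 : j != ord0.
      by apply/eqP => j0; move: hj small; rewrite j0 => <-; lra.
    apply: le_trans (normc_le_sup_norm _ j); rewrite off_axis_lin_shear //.
    have := normcD (v k ord0 j - c j * v k ord0 ord0) (c j * v k ord0 ord0).
    rewrite subrK -hj normcM.
    have := ler_pM (normc_ge0 _) (normc_ge0 _) (nc_c j j0) small.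
    have := ler_wpM2r (sup_norm_ge0 (v k)) rho1; lra.
  have w0 : v k ord0 ord0 != 0.
    by rewrite -normc_gt0 (le_lt_trans _ large) // divr_ge0 // sup_norm_ge0.
  have [i im hi] := HN0 k Nk.
  apply: le_trans (normc_le_sup_norm _ (coord i));
    rewrite off_axis_lin_shear ?coord_neq0 //.
  have -> : v k ord0 (coord i) - c (coord i) * v k ord0 ord0 =
    (v k ord0 (coord i) / v k ord0 ord0 - c (coord i)) * v k ord0 ord0.
    by rewrite mulrBl divfK.
  rewrite normcM -mulrA; apply: ler_pM; rewrite ?divr_ge0 ?sup_norm_ge0 //;
    last exact: ltW.
  apply: ltW; apply: lt_le_trans hi _.
  rewrite /x -(partc i im) /part.
  set z := _ / _; set z' := c _.
  by case: ifP => _; rewrite -raddfB; [apply: normc_ge_Im|apply: normc_ge_Re].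
move=> B.
(* The lower bound is at least 2^j / 8 on the j-th shell. *)
pose J0 := (Num.bound (8 * `|B|)).+1.
have [N1 HN1] := vprop (b%:R ^+ J0).
exists (maxn N0 N1) => k; rewrite geq_max => /andP[Nk0 Nk1].
have vk := HN1 k Nk1.
have Jk : (J0 <= J k)%N by exact: shell_ge.
have v1 : 1 <= sup_norm (v k) by apply: le_trans vk; rewrite exprn_ege1 // ltW.
apply: le_trans (lower k Nk0 v1).
have lb := shell_lb n (sup_norm_ge0 (v k)); rewrite -/(J k) in lb.
have bJ : 2 <= b%:R ^+ J k :> R.
  rewrite -natrX ler_nat -expnM -[2%N]expn1 leq_exp2l // muln_gt0 /=.
  exact: leq_trans Jk.
have B2 : 8 * `|B| <= 2 ^+ J k.
  apply: ltW; apply: lt_trans (archi_boundP _) _; first by rewrite mulr_ge0.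
  rewrite -natrX ltr_nat; apply: leq_ltn_trans (ltn_expl _ (ltnSn 1));
    exact: ltnW.
apply: le_trans (ler_norm _) _.
by apply: shell_radius_arith; rewrite ?exprn_ge0.
Qed.
End GenericProjection.

(** * The Hermitian norm and the real span of a discrete subgroup *)

Section HermitianNorm.
Variables (R : realType) (n : nat).
Local Notation C := R[i].
Local Notation V := 'rV[C]_n.
Implicit Types u v : V.

Lemma hermitian_norm_sqr v :
  hermitian_norm v ^+ 2 = \sum_(j < n) normc (v ord0 j) ^+ 2.
Proof. by rewrite sqr_sqrtr // sumr_ge0 // => j _; rewrite sqr_ge0. Qed.

Lemma hermitian_norm_ge0 v : 0 <= hermitian_norm v.
Proof. exact: sqrtr_ge0. Qed.

(** Expand the sum of the squares of B a_i - A b_i. *)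
Lemma cauchy_schwarz (I : finType) (a b : I -> R) (A B : R) :
  0 <= A -> 0 <= B ->
  \sum_i a i ^+ 2 = A ^+ 2 -> \sum_i b i ^+ 2 = B ^+ 2 ->
  \sum_i a i * b i <= A * B.
Proof.
move=> A0 B0 eA eB.
have sq : 0 <= \sum_i (B * a i - A * b i) ^+ 2 by apply: sumr_ge0 => i _;
  rewrite sqr_ge0.
have E : \sum_i (B * a i - A * b i) ^+ 2 =
   2 * (A * B) * (A * B - \sum_i a i * b i).
  have -> : \sum_i (B * a i - A * b i) ^+ 2 =
    B ^+ 2 * (\sum_i a i ^+ 2) + A ^+ 2 * (\sum_i b i ^+ 2) - 2 * A * B *
      \sum_i a i * b i.
    rewrite !mulr_sumr -big_split /= -sumrB; apply: eq_bigr => i _; ring.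
  rewrite eA eB; ring.
have [/eqP AB|AB] := eqVneq (A * B) 0; last first.
  have AB0 : 0 < A * B by rewrite lt_def AB mulr_ge0.
  by move: sq; rewrite E pmulr_rge0 ?subr_ge0 // mulr_gt0.
have z (c : I -> R) : \sum_i c i ^+ 2 = 0 ^+ 2 -> forall i, c i = 0.
  rewrite expr0n /= => /eqP; rewrite psumr_eq0 => [/allP h i|i _];
    last exact: sqr_ge0.
  by have := h i (mem_index_enum _); rewrite sqrf_eq0 => /eqP.
rewrite (eqP AB); move: AB; rewrite mulf_eq0 => /orP[]/eqP h.
  by rewrite big1 // => i _; rewrite (z a) ?mul0r // eA h.
by rewrite big1 // => i _; rewrite (z b) ?mulr0 // eB h.
Qed.

Lemma hermitian_normD u v :
  hermitian_norm (u + v) <= hermitian_norm u + hermitian_norm v.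
Proof.
rewrite -(ler_pXn2r (_ : (0 < 2)%N)) ?nnegrE ?addr_ge0 ?hermitian_norm_ge0 //.
rewrite sqrrD !hermitian_norm_sqr.
have := cauchy_schwarz (hermitian_norm_ge0 u) (hermitian_norm_ge0 v)
  (esym (hermitian_norm_sqr u)) (esym (hermitian_norm_sqr v)).
move=> cs.
apply: le_trans
  (_ : \sum_j
  (normc (u ord0 j) ^+ 2 + normc (v ord0 j) ^+ 2 + 2 *
  (normc (u ord0 j) * normc (v ord0 j))) <= _).
  apply: ler_sum => j _; rewrite mxE.
  apply: le_trans (_ : (normc (u ord0 j) + normc (v ord0 j)) ^+ 2 <= _).
    by rewrite lerXn2r ?nnegrE ?addr_ge0 ?normc_ge0 // normcD.
  by rewrite le_eqVlt; apply/orP; left; apply/eqP; ring.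
rewrite !big_split /= -mulr_sumr; lra.
Qed.

Lemma sup_norm_le_hermitian v : sup_norm v <= hermitian_norm v.
Proof.
apply: sup_norm_le => [|j]; first exact: hermitian_norm_ge0.
rewrite -(ler_pXn2r (_ : (0 < 2)%N)) ?nnegrE ?normc_ge0 ?hermitian_norm_ge0 //.
by rewrite hermitian_norm_sqr (bigD1 j) //= lerDl sumr_ge0 // => i _;
  rewrite sqr_ge0.
Qed.

Lemma hermitian_le_sup_norm v : hermitian_norm v <= n%:R * sup_norm v.
Proof.
rewrite -(ler_pXn2r (_ : (0 < 2)%N)) ?nnegrE ?mulr_ge0 ?sup_norm_ge0
  ?hermitian_norm_ge0 //.
rewrite hermitian_norm_sqr;
  apply: le_trans (_ : \sum_(j < n) sup_norm v ^+ 2 <= _).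
  by apply: ler_sum => j _;
    rewrite lerXn2r ?nnegrE ?normc_ge0 ?sup_norm_ge0 // normc_le_sup_norm.
rewrite sumr_const card_ord -[leLHS]mulr_natl exprMn ler_wpM2r ?sqr_ge0 //.
by rewrite -natrX ler_nat; case: (n) => // k; rewrite expnS leq_pmulr.
Qed.
End HermitianNorm.

Section RealSpan.
Variables (R : realType) (n : nat).
Local Notation C := R[i].
Local Notation V := 'rV[C]_n.

Definition realify (v : V) : 'rV[R]_(n + n) :=
  row_mx (map_mx (@complex.Re R) v) (map_mx (@complex.Im R) v).

Lemma realifyB u v : realify (u - v) = realify u - realify v.
Proof.
rewrite /realify opp_row_mx add_row_mx; congr row_mx; apply/rowP => j;
  by rewrite !mxE raddfB.
Qed.

HB.instance Definition _ :=
  GRing.isZmodMorphism.Build V 'rV[R]_(n + n) realify realifyB.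

Lemma realify_le v j : `|realify v ord0 j| <= sup_norm v.
Proof.
rewrite /realify; case: (split_ordP j) => i ->; rewrite ?row_mxEl ?row_mxEr mxE;
  apply: le_trans (normc_le_sup_norm v i).
  exact: normc_ge_Re.
exact: normc_ge_Im.
Qed.

Lemma sup_norm_realify v B : (forall j, `|realify v ord0 j| <= B) -> 0 <= B ->
  sup_norm v <= 2 * B.
Proof.
move=> HB B0; apply: sup_norm_le => [|j]; first by rewrite mulr_ge0.
apply: le_trans (normc_le_ReIm _) _.
have := HB (lshift n j); have := HB (rshift n j).
rewrite /realify row_mxEl row_mxEr !mxE; lra.
Qed.

Lemma row_mul_le p q (x : 'rV[R]_p) (M : 'M[R]_(p, q)) (B : R) j :
  (forall i, `|x ord0 i| <= B) -> 0 <= B ->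
  `|(x *m M) ord0 j| <= B * \sum_i \sum_k `|M i k|.
Proof.
move=> xB B0; rewrite mxE mulr_sumr; apply: le_trans (ler_norm_sum _ _ _) _.
apply: ler_sum => i _; rewrite normrM; apply: ler_pM => //.
by rewrite (bigD1 j) //= lerDl sumr_ge0.
Qed.

Lemma discrete_separated (G : set V) : discrete_subset G ->
  exists2 d : R, 0 < d & forall v, G v -> sup_norm v < d -> v = 0.
Proof.
move=> /(_ 0) /= H; apply: contrapT => K;
  apply: H => /= U /nbhs_norm0P [e /= e0 He].
have eE : e = (complex.Re e)%:C by rewrite RRe_real // gtr0_real.
have re0 : 0 < complex.Re e by rewrite -ltcR -eE.
apply: contrapT => K'; apply: K; exists (complex.Re e) => // v Gv ve.
apply: contrapT => v0; apply: K'; exists v; split=> //; first exact/eqP.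
by apply: He; rewrite /= sup_normE eE ltcR.
Qed.

(** Adding [v] to a maximal independent family produces an integer relation, in
    which [v] must occur with a non-zero coefficient; over the reals one can
    divide by it. *)
Lemma rank_span (G : set V) (r : nat) (e : 'I_r -> V) :
  (forall i, G (e i)) -> Z_independent e ->
  (forall k (v : 'I_k -> V), (forall i, G (v i)) -> Z_independent v ->
    (k <= r)%N) ->
  forall v, G v -> (realify v <= (\matrix_i realify (e i)))%MS.
Proof.
move=> Ge ie rmax v Gv.
pose f (i : 'I_r.+1) := if unlift ord_max i is Some j then e j else v.
have nf : ~ Z_independent f.
  move=> /rmax H; have := H _; rewrite ltnn => h; suff: false by [].
  by apply: h => i; rewrite /f; case: unliftP.
have [c [sc [i0 ci0]]] : exists c : 'I_r.+1 ->
  int, \sum_i f i *~ c i = 0 /\ exists i, c i <> 0.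
  apply: contrapT => H; apply: nf => c sc i; apply: contrapT => ci.
  by apply: H; exists c; split=> //; exists i.
have sE : \sum_i e i *~ c (lift ord_max i) + v *~ c ord_max = 0.
  rewrite -[RHS]sc (bigD1_ord ord_max) //= [in RHS]/f unlift_none addrC;
    congr (_ + _).
  by apply: eq_bigr => i _; rewrite liftK.
have cm : c ord_max != 0.
  apply/eqP => cm; apply: ci0; move: sE; rewrite cm mulr0z addr0 => /ie h.
  by case: (unliftP ord_max i0) => [j ->|->].
have cmR : (c ord_max)%:~R != 0 :> R by rewrite intr_eq0.
have -> : realify v = (\row_i (- (c (lift ord_max i))%:~R / (c ord_max)%:~R))
  *m (\matrix_i realify (e i)).
  rewrite mulmx_sum_row; apply: (scalerI cmR).
  have -> : (c ord_max)%:~R *: realify v = realify (v *~ c ord_max).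
    by rewrite raddfMz scaler_int.
  move/eqP: sE; rewrite addrC addr_eq0 => /eqP ->.
  rewrite raddfN raddf_sum scaler_sumr -sumrN; apply: eq_bigr => i _.
  rewrite rowK mxE scalerA mulrCA mulfV // mulr1 scaleNr scaler_int raddfMz.
  by [].
exact: submxMl.
Qed.
End RealSpan.

(** * Counting points of a perturbed lattice *)

Section Lattice.
Variables (R : realType) (n : nat).
Local Notation C := R[i].
Local Notation V := 'rV[C]_n.

(** Take real coordinates with respect to a basis of the real span, scale them
    and round down.  Two points in the same cell differ by a short vector of [G],
    which vanishes by discreteness.  This packing argument avoids proving that
    [G] is a lattice in its span. *)
Lemma subgroup_coordinates (G : set V) (r : nat) : zmod_closed (mem G) ->
  discrete_subset G -> has_Z_rank G r ->
  exists (d : nat) (kappa : V -> 'I_d -> int) (A : nat), [/\ (d <= r)%N,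
    forall v i, (`|kappa v i|)%:~R <= A%:R * (sup_norm v + 1) &
    forall u v, G u -> G v -> kappa u =1 kappa v -> u = v].
Proof.
move=> [G0 GB] /discrete_separated [delta d0 sep] [[e [Ge ie]] rmax].
pose M := \matrix_i realify (e i).
pose B := row_base M.
pose X v := realify v *m pinvmx B.
have XB v : G v -> X v *m B = realify v.
  move=> Gv; apply: mulmxKpV; rewrite eq_row_base;
    exact: rank_span ie rmax v Gv.
pose beta := \sum_i \sum_k `|B i k|.
have beta0 : 0 <= beta by do 2 apply: sumr_ge0 => ? _.
(* The mesh 1/L is chosen so that cells have diameter 2 beta / L < delta. *)
pose L := 2 * beta / delta + 1.
have L0 : 0 < L by rewrite ltr_wpDl // divr_ge0 ?mulr_ge0 // ltW.
pose pp := \sum_i \sum_k `|pinvmx B i k|.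
have pp0 : 0 <= pp by do 2 apply: sumr_ge0 => ? _.
pose A := Num.bound (L * pp + 1).
have hA : L * pp + 1 <= A%:R.
  by apply/ltW/archi_boundP; rewrite addr_ge0 // mulr_ge0 // ltW.
exists (\rank M), (fun v i => Num.floor (L * X v ord0 i)), A; split.
- exact: rank_leq_row.
- move=> v i.
  have Xb : `|X v ord0 i| <= sup_norm v * pp.
    by apply: row_mul_le; [exact: realify_le|exact: sup_norm_ge0].
  set y := L * X v ord0 i.
  have yb : `|y| <= L * pp * sup_norm v.
    by rewrite normrM gtr0_norm // -mulrA ler_pM2l // mulrC.
  have fb : `|(Num.floor y)%:~R| <= `|y| + 1.
    have /andP[h1 h2] := floor_itv y.
    move: h2; rewrite intrD => h2.
    have := ler_norm y; have := ler_norm (- y); rewrite normrN => *.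
    by rewrite ler_norml; apply/andP; split; lra.
  rewrite intr_norm; apply: le_trans fb _.
  apply: le_trans (_ : (L * pp + 1) * (sup_norm v + 1) <= _); last first.
    by rewrite ler_wpM2r // addr_ge0 ?sup_norm_ge0.
  have := sup_norm_ge0 v; have : 0 <= L * pp by rewrite mulr_ge0 // ltW.
  lra.
move=> u v Gu Gv kuv; apply/eqP; rewrite -subr_eq0; apply/eqP.
have Guv : G (u - v).
  by apply/set_mem; apply: GB; apply/mem_set.
apply: sep => //.
have Xd i : `|(X u - X v) ord0 i| <= L^-1.
  rewrite -[leRHS]mul1r ler_pdivlMr //.
  have /andP[h1 h2] := floor_itv (L * X u ord0 i).
  have /andP[h3 h4] := floor_itv (L * X v ord0 i).
  rewrite (kuv i) in h1 h2; move: h2 h4; rewrite !intrD => h2 h4.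
  have -> : (X u - X v) ord0 i = X u ord0 i - X v ord0 i.
    by rewrite [LHS]mxE [X in _ + X]mxE.
  rewrite -[X in _ * X]gtr0_norm // -normrM mulrC ler_norml.
  by rewrite mulrBr; apply/andP; split; lra.
apply: le_lt_trans (sup_norm_realify (B := L^-1 * beta) _ _) _.
- move=> j; rewrite realifyB -(XB u Gu) -(XB v Gv) -mulmxBl.
  by apply: row_mul_le => //; rewrite invr_ge0 ltW.
- by rewrite mulr_ge0 // invr_ge0 ltW.
rewrite mulrCA mulrC ltr_pdivrMr // /L mulrDr mulr1 mulrCA mulfV ?lt0r_neq0 //.
by rewrite mulr1 ltrDl.
Qed.

Lemma subgroup_infinite (G : set V) : zmod_closed (mem G) -> G <> [set 0] ->
  infinite_set G.
Proof.
move=> zG Gnt.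
have [v Gv v0] : exists2 v, G v & v != 0.
  apply: contrapT => H; apply: Gnt; apply/seteqP; split=> [v Gv|_ ->] /=.
    by apply: contrapT => v0; apply: H; exists v => //; apply/eqP.
  by apply/set_mem; case: zG.
have Gn k : G (v *+ k).
  elim: k => [|k IH]; first by rewrite mulr0n; apply/set_mem; case: zG.
  have Gnv := zG.2 _ _ zG.1 (mem_set Gv).
  rewrite sub0r in Gnv.
  rewrite mulrSr -[X in _ + X]opprK; apply/set_mem.
  exact: zG.2 (mem_set IH) Gnv.
have inj : injective (fun k => v *+ k).
  move=> i j /= E.
  have : v *~ (i%:Z - j%:Z) = 0 by rewrite mulrzBr -!pmulrn E subrr.
  move/eqP; rewrite -scaler_int scaler_eq0 (negPf v0) orbF intr_eq0 subr_eq0.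
  by move/eqP => [].
move=> finG; apply: infinite_nat.
have fr : finite_set (range (fun k => v *+ k)).
  by apply: sub_finite_set finG => _ [k _ <-].
by move: fr; rewrite (eq_finite_set (inj_card_eq (in2W inj))).
Qed.

(** The rounded coordinates embed [G] into a countable type, and the multiples
    of one non-zero element make it infinite. *)
Lemma subgroup_enum (G : set V) (r : nat) : zmod_closed (mem G) ->
  discrete_subset G -> has_Z_rank G r -> G <> [set 0] ->
  exists g : nat -> V, injective g /\ range g = G.
Proof.
move=> zG dG rG Gnt.
have [d [kappa [A [_ _ kinj]]]] := subgroup_coordinates zG dG rG.
have Gc : countable G.
  apply/countable_injP; exists (fun v => pickle [ffun i => kappa v i]).
  move=> u v /set_mem Gu /set_mem Gv /(pcan_inj pickleK) E; apply: kinj => // i.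
  by have := congr1 (fun f : {ffun 'I_d -> int} => f i) E; rewrite !ffunE.
have /card_set_bijP [h [_ hinj hsurj]] :=
  eq_card_nat Gc (subgroup_infinite zG Gnt).
have /choice [g Hg] : forall k, exists v, G v /\ h v = k.
  by move=> k; have [v Gv hv] := hsurj k I; exists v.
exists g; split.
  by move=> k l E; rewrite -(Hg k).2 -(Hg l).2 E.
apply/seteqP; split=> [_ [k _ <-]|v Gv]; first exact: (Hg k).1.
exists (h v) => //; apply: hinj; rewrite ?inE //; last exact: (Hg _).2.
exact: (Hg _).1.
Qed.

(** Since [lambda] < 1, a bound on [zeta v] bounds [v] linearly, so the points
    are counted by the integer coordinates of their preimages.  This is where
    the triangle inequality for the Hermitian norm itself is needed: an
    equivalent norm would spoil the constant [lambda]. *)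
Lemma perturbed_count (G : set V) (r : nat) (zeta : V -> V) (lambda K : R)
    (g : nat -> V) :
  zmod_closed (mem G) -> discrete_subset G -> has_Z_rank G r ->
  0 < lambda -> lambda < 1 -> 0 < K ->
  (forall v, G v ->
    hermitian_norm (zeta v - v) <= lambda * hermitian_norm v + K) ->
  injective g -> (forall k, G (g k)) ->
  exists c0 : nat, forall N S : nat,
    (#|[pred k : 'I_N | (sup_norm (zeta (g k)) <= S%:R)%R]| <= c0 * S.+1 ^ r)%N.
Proof.
move=> zG dG rG l0 l1 K0 zb ginj gG.
have [d [kappa [A [dr kb kinj]]]] := subgroup_coordinates zG dG rG.
have l1' : 0 < 1 - lambda by rewrite subr_gt0.
pose A1 := Num.bound ((n%:R + K) / (1 - lambda)).
have hA1 : (n%:R + K) / (1 - lambda) <= A1%:R.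
  by apply/ltW/archi_boundP; apply: divr_ge0; [apply: addr_ge0 => //|];
    exact: ltW.
pose T S := (A * (A1 + 1) * S.+1)%N.
have bound S k : sup_norm (zeta (g k)) <= S%:R ->
  forall i, (`|kappa (g k) i|%N <= T S)%N.
  move=> zS i; rewrite -(ler_nat R) natr_absz; apply: le_trans (kb _ _) _.
  rewrite /T -mulnA natrM ler_wpM2l //.
  have h1 : hermitian_norm (g k) * (1 - lambda) <= n%:R * S%:R + K.
    have := hermitian_normD (zeta (g k)) (g k - zeta (g k));
      rewrite addrC subrK.
    have -> : hermitian_norm (g k - zeta (g k)) = hermitian_norm
      (zeta (g k) - g k).
      by rewrite /hermitian_norm; congr Num.sqrt; apply: eq_bigr => j _;
        rewrite !mxE normcBC.
    have := zb _ (gG k); have := hermitian_le_sup_norm (zeta (g k)).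
    have := ler_wpM2l (ler0n R n) zS; lra.
  have h2 : sup_norm (g k) <= A1%:R * S.+1%:R.
    apply: le_trans (sup_norm_le_hermitian _) _.
    apply: le_trans (_ : (n%:R + K) / (1 - lambda) * S.+1%:R <= _);
      last by rewrite ler_wpM2r.
    rewrite mulrAC ler_pdivlMr //; apply: le_trans h1 _.
    rewrite -natr1; have := ler0n R n; have := mulr_ge0 (ltW K0) (ler0n R S);
      lra.
  by rewrite natrM natrD mulrDl lerD // mul1r ler1n.
exists ((2 * (A * (A1 + 1))).+1 ^ r)%N => N S.
(* The shift by T S makes the coordinates natural numbers at most 2 T S. *)
pose F (k : 'I_N) : {ffun 'I_d -> 'I_(2 * T S).+1} :=
  [ffun i => inord `|kappa (g k) i + (T S)%:Z|].
have Finj :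
  {in [pred k : 'I_N | (sup_norm (zeta (g k)) <= S%:R)%R] &, injective F}.
  move=> k l; rewrite !inE => /bound bk /bound bl E.
  apply/val_inj/ginj/kinj => // i.
  have := congr1 (fun f : {ffun 'I_d -> 'I_(2 * T S).+1} => val (f i)) E.
  rewrite !ffunE /=; have := bk i; have := bl i => h1 h2.
  rewrite !inordK; lia.
rewrite -(card_in_image Finj); apply: leq_trans (max_card _) _.
rewrite card_ffun !card_ord -expnMn.
apply: leq_trans (_ : (2 * T S).+1 ^ r <= _)%N; first by rewrite leq_pexp2l.
case: (posnP r) => [->|r0]; first by rewrite !expn0.
by rewrite leq_exp2r // /T; move: (A * (A1 + 1))%N => X; nia.
Qed.
End Lattice.

(** * Discreteness and tameness of the perturbed lattice *)

Lemma nbhs_avoid_finite (K : numFieldType) (V : normedModType K) (F : set V)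
    (x : V) :
  finite_set F -> nbhs x (~` (F `\ x)).
Proof.
move=> finF; apply: open_nbhs_nbhs; split; last by move=> [_ /(_ erefl)].
apply: closed_openC.
have T1 := hausdorff_accessible (@norm_hausdorff K V).
by apply: (@accessible_finite_set_closed V).1 T1 (F `\` [set x]) _;
  apply: finite_setD.
Qed.

Lemma nbhs_unit_ball (K : numFieldType) (V : normedModType K) (x : V) :
  nbhs x [set y | `|x - y| < 1].
Proof. by apply/nbhs_normP; exists 1 => //=. Qed.

Lemma proper_discrete (R : realType) (n : nat) (v : nat -> 'rV[R[i]]_n) :
  (forall B : R, exists N, forall k, (N <= k)%N -> B <= sup_norm (v k)) ->
  discrete_subset (range v).
Proof.
move=> prop x lx.
have [N HN] := prop (sup_norm x + 1).
have nF := nbhs_avoid_finite x (finite_image v (finite_II N)).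
have nB := nbhs_unit_ball x.
have [y [yx [k _ vk] [yF yB]]] := lx _ (filterI nF nB).
subst y; have [kN|Nk] := ltnP k N.
  by apply: yF; split; [exists k|exact/eqP].
move: yB => /=; rewrite sup_normE -(rmorph1 (real_complex R)) ltcR => yB.
have := HN k Nk; have := sup_normD (v k - x) x; rewrite subrK sup_normBC; lra.
Qed.

Theorem corollary2 (R : realType) (n : nat) (hn : (2 <= n)%N)
  (Gamma : set 'rV[R[i]]_n)
  (Gamma_subgroup : zmod_closed (mem Gamma))
  (Gamma_discrete : discrete_subset Gamma)
  (Gamma_nontrivial : Gamma <> [set 0])
  (r : nat) (Gamma_rank : has_Z_rank Gamma r) (hr : (r <= 2 * n - 3)%N)
  (lambda K : R) (lambda_gt0 : 0 < lambda) (lambda_lt1 : lambda < 1)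
  (K_gt0 : 0 < K)
  (D : set 'rV[R[i]]_n)
  (zeta : 'rV[R[i]]_n -> 'rV[R[i]]_n) (zeta_bij : set_bij Gamma D zeta)
  (zeta_bound : forall v, Gamma v ->
     hermitian_norm (zeta v - v) <= lambda * hermitian_norm v + K) :
  tame_discrete D.
Proof.
case: n hn Gamma Gamma_subgroup Gamma_discrete Gamma_nontrivial Gamma_rank hr
  D zeta
  zeta_bij zeta_bound => [|[|n]] // _ Gamma Gamma_subgroup Gamma_discrete
  Gamma_nontrivial Gamma_rank hr D zeta zeta_bij zeta_bound.
have [g [ginj gG]] :=
  subgroup_enum Gamma_subgroup Gamma_discrete Gamma_rank Gamma_nontrivial.
have Gg k : Gamma (g k) by rewrite -gG; exists k.
have [c0 cnt] := perturbed_count Gamma_subgroup Gamma_discrete Gamma_rank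
  lambda_gt0 lambda_lt1 K_gt0 zeta_bound ginj Gg.
pose v k := zeta (g k).
case: zeta_bij => zfun zinj zsurj.
have vD : range v = D.
  apply/seteqP; split=> [_ [k _ <-]|d /zsurj [u Gu <-]]; first exact: zfun.
  by move: Gu; rewrite -gG => -[k _ <-]; exists k.
have vinj : injective v by move=> k l /zinj E; apply: ginj; apply: E;
  rewrite inE.
split; first by rewrite -vD; apply: proper_discrete; exact: count_proper cnt.
have cnt' N S :
  (#|[pred k : 'I_N | (sup_norm (v k) <= S%:R)%R]|
  <= c0 * S.+1 ^ (n.*2.+2).-1)%N.
  by apply: leq_trans (cnt N S) _; rewrite leq_mul2l leq_pexp2l ?orbT //; lia.
have [c [cinj cprop]] := generic_projection vinj cnt'.
have [phi [aphi phiE]] := straighten cinj cprop.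
exists (phi \o lin_shear c); split.
  exact: automorphism_comp (automorphism_lin_shear c) aphi.
by rewrite -phiE -vD !image_comp.
Qed.
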